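(* Let $\Omega\subset\mathbb{H}$ be an axially symmetric domain, let $m\ge1$ and $\lambda_1,\ldots,\lambda_m\in\mathbb{H}$. Consider the equation $\mathcal{D}_{\lambda_1}\cdots\mathcal{D}_{\lambda_m}f=0$ on $\Omega$ with $f\in\mathcal{SR}(\Omega)$. The generalized exponential function $E_{(\lambda_1,\ldots,\lambda_m)}$ is a solution, and any solution on $\Omega$ is of the form $$f=\sum_{i=1}^m h_i\cdot E_{(\lambda_i,\ldots,\lambda_m)}$$ with $h_i\in\mathcal{SC}(\Omega)$ for every $i$.
   Context: $\mathbb{H}$ is the skew field of quaternions, $\mathbb{S}=\{J\in\mathbb{H}: J^2=-1\}$; the convention $\lambda^0=1$ is used for every $\lambda\in\mathbb{H}$. For an open set $D\subseteq\mathbb{C}$ invariant under complex conjugation, put $\Omega_D=\{\alpha+J\beta:\ \alpha+i\beta\in D,\ J\in\mathbb{S}\}\subseteq\mathbb{H}$. An axially symmetric domain is a connected open set $\Omega=\Omega_D$ of this form. A stem function on $D$ is a map $F=F_1+\imath F_2:D\to\mathbb{H}\otimes_{\mathbb{R}}\mathbb{C}$ ($F_1,F_2$ $\mathbb{H}$-valued, $\imath$ the central imaginary unit of the factor $\mathbb{C}$) with $F(\overline z)=\overline{F(z)}$, conjugation acting on the factor $\mathbb{C}$. It induces the slice function $f=\mathcal{I}(F):\Omega_D\to\mathbb{H}$, $f(\alpha+J\beta)=F_1(\alpha+i\beta)+JF_2(\alpha+i\beta)$. For $F$ of class $C^1$, the slice derivative is $\frac{\partial f}{\partial x}=\mathcal{I}(\frac{\partial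 F}{\partial z})$ with $\frac{\partial}{\partial z}=\frac12(\partial_\alpha-\imath\partial_\beta)$. $f$ is slice-regular if $F$ is holomorphic, i.e. $\frac12(\partial_\alpha+\imath\partial_\beta)F=0$; $\mathcal{SR}(\Omega)$ is the set of slice-regular functions. $\mathcal{SC}(\Omega)$ is the set of slice-constant functions: slice-regular $g$ with $\frac{\partial g}{\partial x}=0$. The slice product of $f=\mathcal{I}(F)$, $g=\mathcal{I}(G)$ is $f\cdot g=\mathcal{I}(FG)$, with $FG$ the pointwise product in $\mathbb{H}\otimes\mathbb{C}$. For $\lambda\in\mathbb{H}$, $\mathcal{D}_\lambda f=\frac{\partial f}{\partial x}-f\lambda$ (pointwise right multiplication by $\lambda$). For $(\mu_1,\ldots,\mu_p)\in\mathbb{H}^p$, $p\ge1$, the generalized exponential function is the entire slice-regular function $$E_{(\mu_1,\ldots,\mu_p)}(x)=\sum_{n=p-1}^{+\infty}\frac{x^n}{n!}\sum_{k_1+\cdots+k_p=n-p+1}\mu_1^{k_1}\cdots\mu_p^{k_p},$$ the inner sum being over non-negative integers $k_1,\ldots,k_p$ (the series converges uniformly on compact sets of $\mathbb{H}$). *)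

(* Defs.v *)
From HB Require Import structures.
From mathcomp Require Import all_boot all_order all_algebra.
From mathcomp Require Import ring.
From mathcomp Require Import all_classical all_reals all_analysis.

Set Implicit Arguments.
Unset Strict Implicit.
Unset Printing Implicit Defensive.

Import Order.TTheory GRing.Theory Num.Theory.
Import numFieldNormedType.Exports.

Local Open Scope classical_set_scope.
Local Open Scope ring_scope.

(* A quaternion a + i b + j c + k d is the row vector (a, b, c, d). The alias
   inherits the topology of R^4; its norm `|x| is the sup norm of
   coordinates and not the quaternionic modulus. *)
Definition quat (R : realType) : Type := 'rV[R]_4.

HB.instance Definition _ (R : realType) := NormedModule.on (quat R).
HB.instance Definition _ (R : realType) := Complete.on (quat R).

Definition mkquat {R : realType} (a b c d : R) : quat R :=
  \row_(l < 4) [:: a; b; c; d]`_l.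

Definition qre {R : realType} (x : quat R) : R := x ord0 (@Ordinal 4 0 isT).
Definition qi {R : realType} (x : quat R) : R := x ord0 (@Ordinal 4 1 isT).
Definition qj {R : realType} (x : quat R) : R := x ord0 (@Ordinal 4 2 isT).
Definition qk {R : realType} (x : quat R) : R := x ord0 (@Ordinal 4 3 isT).

Lemma qreE (R : realType) (a b c d : R) : qre (mkquat a b c d) = a.
Proof. by rewrite /qre mxE. Qed.
Lemma qiE (R : realType) (a b c d : R) : qi (mkquat a b c d) = b.
Proof. by rewrite /qi mxE. Qed.
Lemma qjE (R : realType) (a b c d : R) : qj (mkquat a b c d) = c.
Proof. by rewrite /qj mxE. Qed.
Lemma qkE (R : realType) (a b c d : R) : qk (mkquat a b c d) = d.
Proof. by rewrite /qk mxE. Qed.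

Definition qcoordE := (qreE, qiE, qjE, qkE).

Lemma quatP (R : realType) (x y : quat R) :
  qre x = qre y -> qi x = qi y -> qj x = qj y -> qk x = qk y -> x = y.
Proof.
move=> e0 e1 e2 e3; apply/rowP => -[[|[|[|[|//]]]] p].
- by rewrite (bool_irrelevance p isT).
- by rewrite (bool_irrelevance p isT).
- by rewrite (bool_irrelevance p isT).
- by rewrite (bool_irrelevance p isT).
Qed.

Definition qmul {R : realType} (x y : quat R) : quat R := mkquat
  (qre x * qre y - qi x * qi y - qj x * qj y - qk x * qk y)
  (qre x * qi y + qi x * qre y + qj x * qk y - qk x * qj y)
  (qre x * qj y - qi x * qk y + qj x * qre y + qk x * qi y)
  (qre x * qk y + qi x * qj y - qj x * qi y + qk x * qre y).

Section QuatRing.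
Variable R : realType.
Implicit Types x y z : quat R.

Lemma qreD x y : qre (x + y) = qre x + qre y. Proof. by rewrite /qre mxE. Qed.
Lemma qiD x y : qi (x + y) = qi x + qi y. Proof. by rewrite /qi mxE. Qed.
Lemma qjD x y : qj (x + y) = qj x + qj y. Proof. by rewrite /qj mxE. Qed.
Lemma qkD x y : qk (x + y) = qk x + qk y. Proof. by rewrite /qk mxE. Qed.
Definition qcoordD := (qreD, qiD, qjD, qkD).

Lemma qreZ a x : qre (a *: x) = a * qre x. Proof. by rewrite /qre mxE. Qed.
Lemma qiZ a x : qi (a *: x) = a * qi x. Proof. by rewrite /qi mxE. Qed.
Lemma qjZ a x : qj (a *: x) = a * qj x. Proof. by rewrite /qj mxE. Qed.
Lemma qkZ a x : qk (a *: x) = a * qk x. Proof. by rewrite /qk mxE. Qed.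
Definition qcoordZ := (qreZ, qiZ, qjZ, qkZ).

Lemma qmulA : associative (@qmul R).
Proof. by move=> x y z; apply: quatP; rewrite /qmul !qcoordE; ring. Qed.

Lemma qmul1l : left_id (mkquat 1 0 0 0) (@qmul R).
Proof. by move=> x; apply: quatP; rewrite /qmul !qcoordE; ring. Qed.

Lemma qmul1r : right_id (mkquat 1 0 0 0) (@qmul R).
Proof. by move=> x; apply: quatP; rewrite /qmul !qcoordE; ring. Qed.

Lemma qmulDl : left_distributive (@qmul R) +%R.
Proof.
by move=> x y z; apply: quatP; rewrite /qmul !(qcoordE, qcoordD); ring.
Qed.

Lemma qmulDr : right_distributive (@qmul R) +%R.
Proof.
by move=> x y z; apply: quatP; rewrite /qmul !(qcoordE, qcoordD); ring.
Qed.

Lemma qone_neq0 : mkquat 1 0 0 0 != 0 :> quat R.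
Proof.
apply/eqP => /(congr1 qre); rewrite qreE /qre mxE.
by move/eqP; rewrite oner_eq0.
Qed.

HB.instance Definition _ := GRing.Zmodule_isNzRing.Build (quat R)
  qmulA qmul1l qmul1r qmulDl qmulDr qone_neq0.

Lemma qscalerAl (a : R) x y : a *: (x * y) = (a *: x) * y.
Proof.
by apply: quatP; rewrite /GRing.mul /= /qmul !(qcoordE, qcoordZ); ring.
Qed.

Lemma qscalerAr (a : R) x y : a *: (x * y) = x * (a *: y).
Proof.
by apply: quatP; rewrite /GRing.mul /= /qmul !(qcoordE, qcoordZ); ring.
Qed.

HB.instance Definition _ := GRing.Lmodule_isLalgebra.Build R (quat R) qscalerAl.
HB.instance Definition _ := GRing.Lalgebra_isAlgebra.Build R (quat R) qscalerAr.

End QuatRing.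

Definition imag_units {R : realType} : set (quat R) := [set J | J ^+ 2 = -1].

(* H (x)_R C: the pair (a, b) stands for a + iota b with iota central and
   iota ^ 2 = -1. The alias keeps the componentwise product of pairs away. *)
Definition cquat (R : realType) : Type := (quat R * quat R)%type.

HB.instance Definition _ (R : realType) := NormedModule.on (cquat R).

Definition cqmul {R : realType} (p q : cquat R) : cquat R :=
  (p.1 * q.1 - p.2 * q.2, p.1 * q.2 + p.2 * q.1).

Section CquatRing.
Variable R : realType.

Lemma cqmulA : associative (@cqmul R).
Proof.
move=> [a b] [c d] [e f]; rewrite /cqmul /=; congr pair.
- rewrite !(mulrDl, mulrDr, mulrN, mulNr) !mulrA !opprD -!addrA.
  by congr (_ + _); rewrite addrA [RHS]addrC.
- rewrite !(mulrDl, mulrDr, mulrN, mulNr) !mulrA -!addrA.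
  by congr (_ + _); rewrite addrA [RHS]addrC.
Qed.

Lemma cqmul1l : left_id ((1, 0) : cquat R) (@cqmul R).
Proof. by move=> [a b]; rewrite /cqmul /= !mul1r !mul0r subr0 addr0. Qed.

Lemma cqmul1r : right_id ((1, 0) : cquat R) (@cqmul R).
Proof. by move=> [a b]; rewrite /cqmul /= !mulr1 !mulr0 subr0 add0r. Qed.

Lemma cqmulDl : left_distributive (@cqmul R) +%R.
Proof.
move=> [a b] [c d] [e f]; rewrite /cqmul; congr pair; rewrite /= !mulrDl.
- by rewrite opprD addrACA.
- by rewrite addrACA.
Qed.

Lemma cqmulDr : right_distributive (@cqmul R) +%R.
Proof.
move=> [a b] [c d] [e f]; rewrite /cqmul; congr pair; rewrite /= !mulrDr.
- by rewrite opprD addrACA.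
- by rewrite addrACA.
Qed.

Lemma cqone_neq0 : ((1, 0) : cquat R) != 0.
Proof. by apply/eqP => -[/eqP]; rewrite oner_eq0. Qed.

HB.instance Definition _ := GRing.Zmodule_isNzRing.Build (cquat R)
  cqmulA cqmul1l cqmul1r cqmulDl cqmulDr cqone_neq0.

End CquatRing.

Definition iota_unit {R : realType} : cquat R := (0, 1).

Definition cqconj {R : realType} (p : cquat R) : cquat R := (p.1, - p.2).

(* The complex plane is R * R, alpha + i beta being the pair (alpha, beta). *)
Definition conjp {R : realType} (z : R * R) : R * R := (z.1, - z.2).

Definition slice_point {R : realType} (z : R * R) (J : quat R) : quat R :=
  z.1%:A + z.2 *: J.

Definition circularization {R : realType} (D : set (R * R)) : set (quat R) :=
  [set x | exists2 z, D z & exists2 J, imag_units J & x = slice_point z J].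

(* Openness of circularization D follows from that of D. *)
Definition axially_symmetric_domain {R : realType} (D : set (R * R)) : Prop :=
  [/\ open D, (forall z, D z -> D (conjp z)) & connected (circularization D)].

Definition stem {R : realType} (D : set (R * R)) (F : R * R -> cquat R) : Prop :=
  forall z, D z -> F (conjp z) = cqconj (F z).

Definition induces {R : realType} (D : set (R * R)) (F : R * R -> cquat R)
    (f : quat R -> quat R) : Prop :=
  forall z J, D z -> imag_units J -> f (slice_point z J) = (F z).1 + J * (F z).2.

Definition imabs {R : realType} (x : quat R) : R :=
  Num.sqrt (qi x ^+ 2 + qj x ^+ 2 + qk x ^+ 2).

(* The value at a real x is immaterial. *)
Definition imdir {R : realType} (x : quat R) : quat R :=
  if imabs x == 0 then mkquat 0 1 0 0
  else (imabs x)^-1 *: mkquat 0 (qi x) (qj x) (qk x).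

(* The slice function I(F), evaluated through x = Re x + J |Im x|; for a stem
   function the choice of J does not matter, see slice_fun_induces. *)
Definition slice_fun {R : realType} (F : R * R -> cquat R) (x : quat R) : quat R :=
  (F (qre x, imabs x)).1 + imdir x * (F (qre x, imabs x)).2.

Section SliceFun.
Variable R : realType.
Implicit Types (D : set (R * R)) (F : R * R -> cquat R).

Lemma imag_unitsP (J : quat R) : imag_units J ->
  qre J = 0 /\ qi J ^+ 2 + qj J ^+ 2 + qk J ^+ 2 = 1.
Proof.
rewrite /imag_units /= expr2 => h.
have N1 : (- 1 : quat R) = mkquat (-1) 0 0 0.
  have q1 : (1 : quat R) = mkquat 1 0 0 0 by [].
  rewrite -scaleN1r q1.
  by apply: quatP; rewrite !(qcoordZ, qcoordE) ?mulr1 ?mulr0.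
have e0 := congr1 qre h; have e1 := congr1 qi h.
have e2 := congr1 qj h; have e3 := congr1 qk h.
move: e0 e1 e2 e3; rewrite N1 /GRing.mul /= /qmul !qcoordE => e0 e1 e2 e3.
have r0 : qre J = 0.
  apply/eqP; apply/negP => /negP rN0.
  have dbl0 (t : R) : qre J * t + qre J * t = 0 -> t = 0.
    rewrite -mulr2n => /eqP; rewrite mulrn_eq0 /= mulf_eq0 (negbTE rN0) /=.
    by move/eqP.
  have i0 : qi J = 0 by apply: dbl0; rewrite -e1; ring.
  have j0 : qj J = 0 by apply: dbl0; rewrite -e2; ring.
  have k0 : qk J = 0 by apply: dbl0; rewrite -e3; ring.
  have := sqr_ge0 (qre J); suff -> : qre J ^+ 2 = -1 by rewrite oppr_ge0 ler10.
  by rewrite -e0 i0 j0 k0; ring.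
split=> //; move: e0; rewrite r0 => e0.
by rewrite -[RHS]opprK -e0; ring.
Qed.

Lemma slice_fun_induces D F : stem D F -> induces D F (slice_fun F).
Proof.
move=> stF [a b] J Dz /imag_unitsP[J0 J1]; rewrite /slice_fun.
set x := slice_point _ _.
have xr : qre x = a.
  by rewrite /x /slice_point qreD !qreZ J0 mulr0 addr0 qreE mulr1.
have xi : qi x = b * qi J.
  by rewrite /x /slice_point qiD !qiZ qiE mulr0 add0r.
have xj : qj x = b * qj J.
  by rewrite /x /slice_point qjD !qjZ qjE mulr0 add0r.
have xk : qk x = b * qk J.
  by rewrite /x /slice_point qkD !qkZ qkE mulr0 add0r.
have xn : imabs x = `|b|.
  by rewrite /imabs xi xj xk !exprMn -!mulrDr J1 mulr1 sqrtr_sqr.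
rewrite /imdir xn xr normr_eq0; have [b0|bN0] := eqVneq b 0.
  have := stF _ Dz; rewrite /conjp /cqconj /= b0 oppr0 normr0.
  case: (F (a, 0)) => u v /= [/eqP]; rewrite -addr_eq0 -mulr2n -scaler_nat.
  by rewrite scaler_eq0 pnatr_eq0 /= => /eqP ->; rewrite !mulr0.
have Jim : mkquat 0 (qi x) (qj x) (qk x) = b *: J.
  by apply: quatP; rewrite !(qcoordE, qcoordZ) ?J0 ?mulr0.
rewrite Jim scalerA; have [b_gt0|b_lt0|b0] := ltrgt0P b.
- by rewrite mulVf // scale1r.
- have := stF _ Dz; rewrite /conjp /= => ->; rewrite /cqconj /=.
  by rewrite invrN mulNr mulVf // scaleN1r mulrNN.
- by rewrite b0 eqxx in bN0.
Qed.

Lemma induces_inj D F G (f : quat R -> quat R) :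
  induces D F f -> induces D G f -> forall z, D z -> F z = G z.
Proof.
move=> hF hG z Dz.
pose J : quat R := mkquat 0 1 0 0.
have JJ : J * J = -1.
  rewrite -scaleN1r (_ : (1 : quat R) = mkquat 1 0 0 0) //.
  by apply: quatP; rewrite /GRing.mul /= /qmul !(qcoordE, qcoordZ); ring.
have SJ : imag_units J by rewrite /imag_units /= expr2.
have SNJ : imag_units (- J) by rewrite /imag_units /= sqrrN expr2.
have := hF _ _ Dz SJ; rewrite (hG _ _ Dz SJ).
have := hF _ _ Dz SNJ; rewrite (hG _ _ Dz SNJ).
case: (F z) (G z) => [a b] [c d] /=; rewrite !mulNr => eN eP.
have e1 : 2%:R *: c = 2%:R *: a.
  have := congr2 +%R eN eP.
  by rewrite addrACA addNr addr0 addrACA addNr addr0 !scaler_nat !mulr2n.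
have ca : c = a.
  by apply: (scalerI (a := 2%:R : R)) => //; rewrite pnatr_eq0.
have e2 : J * d = J * b by move: eP; rewrite ca => /addrI.
have := congr1 ( *%R J) e2; rewrite !mulrA JJ !mulN1r => /oppr_inj ->.
by rewrite ca.
Qed.

End SliceFun.

(* By induces_inj, only the values outside D depend on the choice. *)
Definition stem_of {R : realType} (D : set (R * R)) (f : quat R -> quat R) :
    R * R -> cquat R :=
  xget (fun=> 0) [set F | stem D F /\ induces D F f].

Definition d_alpha {R : realType} (F : R * R -> cquat R) : R * R -> cquat R :=
  'D_((1, 0) : R * R) F.

Definition d_beta {R : realType} (F : R * R -> cquat R) : R * R -> cquat R :=
  'D_((0, 1) : R * R) F.

Definition stem_C1 {R : realType} (D : set (R * R)) (F : R * R -> cquat R) : Prop :=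
  forall z, D z ->
    [/\ derivable F z (1, 0), derivable F z (0, 1),
        {for z, continuous (d_alpha F)} & {for z, continuous (d_beta F)}].

Definition d_z {R : realType} (F : R * R -> cquat R) (z : R * R) : cquat R :=
  2^-1 *: (d_alpha F z - iota_unit * d_beta F z).

Definition d_zbar {R : realType} (F : R * R -> cquat R) (z : R * R) : cquat R :=
  2^-1 *: (d_alpha F z + iota_unit * d_beta F z).

Definition slice_regular {R : realType} (D : set (R * R))
    (f : quat R -> quat R) : Prop :=
  exists F, [/\ stem D F, induces D F f, stem_C1 D F &
                forall z, D z -> d_zbar F z = 0].

Definition slice_derivative {R : realType} (D : set (R * R))
    (f : quat R -> quat R) : quat R -> quat R :=
  slice_fun (d_z (stem_of D f)).

Definition slice_constant {R : realType} (D : set (R * R))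
    (g : quat R -> quat R) : Prop :=
  slice_regular D g /\
  forall x, circularization D x -> slice_derivative D g x = 0.

Definition slice_mul {R : realType} (D : set (R * R))
    (f g : quat R -> quat R) : quat R -> quat R :=
  slice_fun (fun z => stem_of D f z * stem_of D g z).

Definition slice_op {R : realType} (D : set (R * R)) (lambda : quat R)
    (f : quat R -> quat R) : quat R -> quat R :=
  fun x => slice_derivative D f x - f x * lambda.

(* D_(lambda_1) ... D_(lambda_m) f; the last operator of the list acts first. *)
Definition slice_ops {R : realType} (D : set (R * R)) (lambda : seq (quat R))
    (f : quat R -> quat R) : quat R -> quat R :=
  foldr (slice_op D) f lambda.

(* The sum of mu_1 ^ k_1 * ... * mu_p ^ k_p over k_1 + ... + k_p = N, the
   factors in this order. *)
Definition gexp_coef {R : realType} (mu : seq (quat R)) (N : nat) : quat R :=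
  \sum_(k : {ffun 'I_(size mu) -> 'I_N.+1} | (\sum_i k i)%N == N)
    \prod_(i < size mu) mu`_i ^+ k i.

(* E_mu, meant for nonempty mu; n.+1 - size mu is n - p + 1. *)
Definition gexp {R : realType} (mu : seq (quat R)) (x : quat R) : quat R :=
  \big[+%R/0]_((size mu).-1 <= n <oo)
    ((n`!%:R : R)^-1 *: x ^+ n * gexp_coef mu (n.+1 - size mu)).

(* Main.v *)
Require Import Defs.
From mathcomp Require Import all_boot all_order all_algebra.
From mathcomp Require Import ring lra.
From mathcomp Require Import all_classical all_reals all_analysis.

Set Implicit Arguments.
Unset Strict Implicit.
Unset Printing Implicit Defensive.

Import Order.TTheory GRing.Theory Num.Theory.
Import numFieldNormedType.Exports.

Local Open Scope classical_set_scope.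
Local Open Scope ring_scope.

(** Everything is done on stem functions, where the equation becomes an
   ordinary linear one for holomorphic functions with values in H (x) C.
   Write E_s for the stem function of [gexp s]. The recursion
   h_(N+1)(s, m) = h_(N+1)(s) + h_N(s, m) m of the complete homogeneous sums
   gives E_(s,m)' = E_s + E_(s,m) m, so the operator attached to m sends
   E_(s,m) to E_s, and E_s is killed by induction, E_() being 0.
   Conversely, peel off the last entry m: by induction F' - F m is a
   combination of the E_(lambda_i, ..) with slice constant left coefficients,
   the same combination of the E_(lambda_i, .., m) has the same image, and the
   difference U satisfies U' = U m, so that U E_(-m) is slice constant and
   U = (U E_(-m)) E_m.

   The induction needs the derivative of a C^1 holomorphic function to be C^1
   again. For f = u + i v with f' = p + i q, put
     M(s) = int_0^(2 pi) u cos t + v sin t dt,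
     A(s) = int_0^(2 pi) p dt   on the circle of radius s about z.
   Integrating d/dt (u sin t - v cos t) gives M = s A, differentiating in s
   gives M' = A, hence A is constant and p(z) = M(s) / (2 pi s); now
   differentiate this formula in z under the integral sign. *)

(** * Integrals over a period with a parameter *)

Lemma continuous_pair_at (S T U : topologicalType) (f : S -> T) (g : S -> U) x :
  {for x, continuous f} -> {for x, continuous g} ->
  {for x, continuous (fun y => (f y, g y))}.
Proof. by move=> cf cg; exact: (cvg_pair cf cg). Qed.

Section CircleIntegral.
Variable R : realType.
Implicit Types (f g : R -> R) (c : R).

Definition cint f : R := \int[lebesgue_measure]_(t in `[0, 2 * pi]) f t.

Lemma two_pi_gt0 : 0 < 2 * pi :> R.
Proof. by rewrite mulr_gt0// pi_gt0. Qed.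

Lemma cint_integrable f : continuous f ->
  (@lebesgue_measure R).-integrable `[0, 2 * pi] (EFin \o f).
Proof.
move=> cf; apply: continuous_compact_integrable; first exact: segment_compact.
exact: continuous_subspaceT.
Qed.

Lemma cintB f g : continuous f -> continuous g ->
  cint (fun t => f t - g t) = cint f - cint g.
Proof. by move=> cf cg; apply: RintegralB => //; exact: cint_integrable. Qed.

Lemma cintZ c f : continuous f -> cint (fun t => c * f t) = c * cint f.
Proof. by move=> cf; apply: RintegralZl => //; exact: cint_integrable. Qed.

Lemma cint_cst c : cint (fun=> c) = 2 * pi * c.
Proof.
rewrite /cint Rintegral_cst//. rewrite [X in fine X]lebesgue_measure_itv/= lte_fin two_pi_gt0.
by rewrite oppr0 adde0 mulrC.
Qed.

Lemma cint_le f c : continuous f -> (forall t, t \in `[0, 2 * pi] -> `|f t| <= c) ->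
  `|cint f| <= 2 * pi * c.
Proof.
move=> cf fc; rewrite -cint_cst.
apply: (@le_trans _ _ (cint (fun t => `|f t|))).
  by apply: le_normr_Rintegral => //; exact: cint_integrable.
apply: le_Rintegral => //.
- apply: (cint_integrable (f := fun t => `|f t|)) => t.
  by apply: (continuous_comp (cf t)); exact: norm_continuous.
- by apply: (cint_integrable (f := fun=> c)) => t; exact: cst_continuous.
Qed.

Lemma cint_FTC f g : (forall t : R, is_derive t (1 : R) f (g t)) -> continuous g ->
  cint g = f (2 * pi) - f 0.
Proof.
move=> fg cg; rewrite /cint /Rintegral (@continuous_FTC2 _ g f)//.
- exact: two_pi_gt0.
- exact: continuous_subspaceT.
- have cf : continuous f.
    by move=> t; apply/differentiable_continuous/derivable1_diffP; case: (fg t).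
  split; first by move=> t _; case: (fg t).
  + exact/cvg_at_right_filter/cf.
  + exact/cvg_at_left_filter/cf.
- by move=> t _; rewrite derive1E derive_val.
Qed.

(** Compactness of the period turns an estimate local in [t] into one uniform in [t], as limits
    under the integral sign require. *)
Lemma near_segment (T : Type) (F : set_system T) {FF : Filter F}
    (P : T -> R -> Prop) :
  (forall t, t \in `[0, 2 * pi] -> \forall t' \near t & i \near F, P i t') ->
  \near F, forall t, t \in `[0, 2 * pi] -> P F t.
Proof.
move=> h; have /compact_near_coveringP := @segment_compact R 0 (2 * pi).
by move=> /(_ _ F P FF h).
Qed.

Lemma cvg_cint (T : Type) (F : set_system T) {FF : Filter F} (f : T -> R -> R) g :
  continuous g -> (\near F, continuous (f F)) ->
  (forall e, 0 < e -> \near F, forall t, t \in `[0, 2 * pi] -> `|g t - f F t| <= e) ->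
  cint (f i) @[i --> F] --> cint g.
Proof.
move=> cg cf fg; apply/cvgrPdist_le => e e0.
have e1 : 0 < e / (2 * pi) by rewrite divr_gt0// two_pi_gt0.
near=> i; have ci : continuous (f i) by near: i.
rewrite -cintB//; rewrite [leRHS](_ : _ = 2 * pi * (e / (2 * pi))); last first.
  by rewrite mulrC divfK// gt_eqF// two_pi_gt0.
apply: cint_le; last by near: i; exact: fg.
by move=> t; apply: cvgB; [exact: cg|exact: ci].
Unshelve. all: by end_near. Qed.

Lemma continuous_slice (T U : topologicalType) (f : T * R -> U) y :
  (forall t, {for (y, t), continuous f}) -> continuous (fun t => f (y, t)).
Proof.
move=> h t; apply: (@continuous_comp _ _ _ (fun t => (y, t)) f); last exact: h.
by apply: continuous_pair_at; [exact: cst_continuous|exact: cvg_id].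
Qed.

(* The parameter will be the radius, then the centre of a circle. *)
Lemma continuous_cint (T : topologicalType) (f : T * R -> R) (x : T) :
  (\forall y \near x, forall t, {for (y, t), continuous f}) ->
  cint (fun t => f (y, t)) @[y --> x] --> cint (fun t => f (x, t)).
Proof.
move=> cf.
have slice := @continuous_slice T R.
have cx := nbhs_singleton cf.
apply: (@cvg_cint _ _ _ (fun y t => f (y, t))); first exact: slice.
- by apply: filterS cf => y /slice.
move=> e e0; apply: near_segment => t _.
have /cvgrPdist_lt/(_ _ (divr_gt0 e0 (ltr0Sn R 1))) ct := cx t.
case: ct => -[U V] [/= Ux Vt] UV.
exists (V, U) => //= -[t' y] [/= Vt' Uy].
have h1 := UV (y, t') (conj Uy Vt').
have h2 := UV (x, t') (conj (nbhs_singleton Ux) Vt').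
rewrite /= in h1 h2.
(* Both points lie in the chosen neighbourhood of [(x, t)], so each value is within [e / 2] of
   [f (x, t)]. *)
rewrite (_ : f (x, t') - f (y, t') =
  (f (x, t) - f (y, t')) - (f (x, t) - f (x, t'))); last by ring.
by apply: (le_trans (ler_normB _ _)); rewrite [leRHS]splitr lerD// ltW.
Qed.

End CircleIntegral.

(** * Mean values and differentiation under the integral sign *)

Section PlaneCalculus.
Variable R : realType.
Implicit Types (u : R * R -> R) (z : R * R).

Lemma is_deriveP (V W : normedModType R) (f : V -> W) (a v : V) (df : W) :
  h^-1 *: (f (h *: v + a) - f a) @[h --> 0^'] --> df <-> is_derive a v f df.
Proof.
split=> [fdf|[fav <-]]; last exact: fav.
by apply: DeriveDef; [apply/cvg_ex; exists df|exact: cvg_lim].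
Qed.

Lemma is_derive_line (V W : normedModType R) (f : V -> W) (a v : V) (t : R) df :
  is_derive (a + t *: v) v f df -> is_derive t (1 : R) (fun s => f (a + s *: v)) df.
Proof.
move/is_deriveP => h; apply/is_deriveP; apply: cvg_trans h; apply: near_eq_cvg.
near=> h; congr (_ *: (f _ - _)).
by rewrite scalerDl addrCA [h *: 1]mulr1.
Unshelve. all: by end_near. Qed.

(** The two distance bounds together say that [y] lies between [x] and [x + h]; in this form no case
    distinction on the sign of [h] reaches the callers. *)
Lemma MVT_abs (f df : R -> R) (x h : R) :
  (forall y, `|y - x| <= `|h| -> `|y - (x + h)| <= `|h| ->
     is_derive y (1 : R) f (df y)) ->
  exists y, [/\ `|y - x| <= `|h|, `|y - (x + h)| <= `|h| &
    f (x + h) - f x = df y * h].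
Proof.
move=> fdf; pose I := `[Num.min x (x + h), Num.max x (x + h)].
have yI y : y \in I -> `|y - x| <= `|h| /\ `|y - (x + h)| <= `|h|.
  rewrite in_itv/= !ler_norml; rewrite /Num.min /Num.max.
  by case: ifPn; case: (ger0P h) => ? ? /andP[? ?]; split; apply/andP; split; lra.
have cI : {within [set` I], continuous f}.
  apply: derivable_within_continuous => y /yI[h1 h2].
  by case: (fdf y h1 h2).
have [||y /yI[h1 h2] E] := @MVT_segment _ f df _ _ _ _ cI.
- by rewrite ge_min !le_max lexx.
- by move=> y /subset_itv_oo_cc /yI[h1 h2]; exact: fdf.
exists y; split=> //; move: E; rewrite /Num.min /Num.max; case: ifP => _ E.
  by rewrite E addrC addKr.
by rewrite -opprB E opprD addNKr mulrN opprK.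
Qed.

(** By the mean value theorem the difference quotient at [t] equals [g (y, t)] with [y] between [x]
    and [x + h]. Continuity of [g] and compactness of the period make this tend to [g (x, t)]
    uniformly in [t]. *)
Lemma is_derive_cint (f g : R * R -> R) (x : R) :
  (\forall y \near x, forall t, [/\ is_derive y (1 : R) (fun y => f (y, t)) (g (y, t)),
     {for (y, t), continuous f} & {for (y, t), continuous g}]) ->
  is_derive x (1 : R) (fun y => cint (fun t => f (y, t))) (cint (fun t => g (x, t))).
Proof.
move=> fg; apply/is_deriveP.
have slice := @continuous_slice R R.
have fgx := nbhs_singleton fg.
have cfx : continuous (fun t => f (x, t)) by apply: slice => t; case: (fgx t).
have cfn : \forall y \near x, forall t, {for (y, t), continuous f}.
  by apply: filterS fg => y fgy t; case: (fgy t).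
have near0 : \forall h \near (0 : R), continuous (fun t => f (h *: 1 + x, t)).
  have : \forall h \near (0 : R), forall t, {for (h *: 1 + x, t), continuous f}.
    have : (fun h : R => h *: 1 + x) h @[h --> (0 : R)] --> x.
      rewrite -[X in _ --> X]add0r; apply: cvgD; last exact: cvg_cst.
      rewrite -[X in _ --> X](scale0r (1 : R)).
      by apply: cvgZr_tmp; exact: cvg_id.
    by move=> /(_ _ cfn).
  by apply: filterS => h; exact: slice.
(* Linearity of [cint] is available for continuous integrands, hence only for [h] near 0; this is
   why the equality is one of filters and not of functions. *)
have -> : (fun h : R => h^-1 *: (cint (fun t => f (h *: 1 + x, t)) -
      cint (fun t => f (x, t)))) @ 0^' =
    (fun h : R => cint (fun t => h^-1 * (f (h *: 1 + x, t) - f (x, t)))) @ 0^'.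
  rewrite eqEsubset; split; apply: near_eq_cvg; apply: cvg_within;
    apply: filterS near0 => h ch.
  - by rewrite cintZ ?cintB// => t; apply: cvgB; [exact: ch|exact: cfx].
  - by rewrite cintZ ?cintB// => t; apply: cvgB; [exact: ch|exact: cfx].
apply: (@cvg_cint _ _ _ _ (fun (h : R) t =>
  h^-1 * (f (h *: 1 + x, t) - f (x, t))) (fun t => g (x, t))).
- by apply: slice => t; case: (fgx t).
- apply: cvg_within; apply: filterS near0 => h ch t.
  by apply: cvgM; [exact: cvg_cst|apply: cvgB; [exact: ch|exact: cfx]].
move=> e e0; apply: near_segment => t _.
have [_ _ cgt] := fgx t.
have /cvgrPdist_lt/(_ _ (divr_gt0 e0 (ltr0Sn R 1))) ct := cgt.
case: ct => -[U V] [/= Ux Vt] UV.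
have [d /= d0 xd] := (nbhs_ballP _ _).1 (filterI Ux fg).
exists (V, [set h | h != 0 /\ `|h| < d]) => /=.
  split=> //; rewrite /within/=; apply/(nbhs_ballP _ _).2; exists d => //= h.
  by rewrite /ball/= sub0r normrN.
move=> [t' h] [/= Vt' [h0 hd]].
have xd' y : `|y - x| <= `|h| -> ball x d y.
  by move=> yx; rewrite /ball/= distrC (le_lt_trans yx).
have [|y [yx _ E]] := @MVT_abs (fun y => f (y, t')) (fun y => g (y, t')) x h.
  by move=> y /xd' /xd [_ /(_ t')[]].
rewrite [h *: 1]mulr1 addrC [h + x]addrC E.
rewrite [X in `|X|](_ : _ = (g (x, t) - g (y, t')) - (g (x, t) - g (x, t'))).
  apply: (le_trans (ler_normB _ _)); rewrite [leRHS]splitr lerD// ltW//.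
    by apply: (UV (y, t')); split=> //=; have [] := xd _ (xd' _ yx).
  by apply: (UV (x, t')); split=> //=; exact: nbhs_singleton.
by field.
Qed.

End PlaneCalculus.

(** * Functions of two real variables with continuous partial derivatives *)

Section PartialDerivatives.
Variable R : realType.
Implicit Types (D : set (R * R)) (u : R * R -> R) (z : R * R).

Definition partials_on D u (ua ub : R * R -> R) := forall z, D z ->
  [/\ is_derive z ((1, 0) : R * R) u (ua z), is_derive z ((0, 1) : R * R) u (ub z),
      {for z, continuous ua} & {for z, continuous ub}].

Lemma plane_shift1 (a b t : R) : (a, b) + t *: ((1, 0) : R * R) = (a + t, b).
Proof. by rewrite -[LHS]/(a + t * 1, b + t * 0) mulr1 mulr0 addr0. Qed.

Lemma plane_shift2 (a b t : R) : (a, b) + t *: ((0, 1) : R * R) = (a, b + t).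
Proof. by rewrite -[LHS]/(a + t * 0, b + t * 1) mulr1 mulr0 addr0. Qed.

(** Go from [q] to [p] along a vertical and then a horizontal segment and apply the mean value
    theorem on each. Balls of the plane are squares, so the corner and both intermediate points stay
    in the ball where [ua] and [ub] vary by at most [e]. *)
Lemma partials_increment D u ua ub z e : open D -> partials_on D u ua ub ->
  D z -> 0 < e -> exists2 d, 0 < d & forall p q, ball z d p -> ball z d q ->
  `|u p - u q - ((p.1 - q.1) * ua z + (p.2 - q.2) * ub z)| <=
    e * (`|p.1 - q.1| + `|p.2 - q.2|).
Proof.
move=> oD pu Dz e0; have [_ _ ca cb] := pu z Dz.
have /cvgrPdist_le/(_ _ e0) na := ca.
have /cvgrPdist_le/(_ _ e0) nb := cb.
have [d /= d0 zd] := (nbhs_ballP _ _).1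
  (filterI (open_nbhs_nbhs (conj oD Dz)) (filterI na nb)).
exists d => // -[p1 p2] [q1 q2] [/= zp1 zp2] [/= zq1 zq2].
have btw (a b h y : R) : ball a d b -> ball a d (b + h) -> `|y - b| <= `|h| ->
    `|y - (b + h)| <= `|h| -> ball a d y.
  rewrite /ball/= !ltr_norml !ler_norml => /andP[h1 h2] /andP[h3 h4].
  by case: (ger0P h) => hh /andP[h5 h6] /andP[h7 h8]; apply/andP; split; lra.
have E1 (y : R) := plane_shift1 q1 p2 y; have E2 (y : R) := plane_shift2 q1 q2 y.
have qp (a b : R) : b + (a - b) = a by rewrite addrC subrK.
(* The horizontal side, from the corner [(q1, p2)] to [p]. *)
have [|y [y1 y2 Ey]] := @MVT_abs _ (fun s => u ((q1, p2) + s *: ((1, 0) : R * R)))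
    (fun s => ua ((q1, p2) + s *: ((1, 0) : R * R))) 0 (p1 - q1).
  rewrite add0r => y; rewrite subr0 => y1 y2.
  apply: is_derive_line; rewrite E1; have [|+ _] := zd (q1 + y, p2).
    split=> //=; apply: (btw _ q1 (p1 - q1)); rewrite ?qp//.
      by rewrite addrC addKr.
    by rewrite [X in `|X|](_ : _ = y - (p1 - q1))//; ring.
  by move=> /pu[].
(* The vertical side, from [q] to the corner [(q1, p2)]. *)
have [|x [x1 x2 Ex]] := @MVT_abs _ (fun s => u ((q1, q2) + s *: ((0, 1) : R * R)))
    (fun s => ub ((q1, q2) + s *: ((0, 1) : R * R))) 0 (p2 - q2).
  rewrite add0r => x; rewrite subr0 => x1 x2.
  apply: is_derive_line; rewrite E2; have [|+ _] := zd (q1, q2 + x).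
    split=> //=; apply: (btw _ q2 (p2 - q2)); rewrite ?qp//.
      by rewrite addrC addKr.
    by rewrite [X in `|X|](_ : _ = x - (p2 - q2))//; ring.
  by move=> /pu[].
rewrite !E1 add0r qp addr0 subr0 in Ey y1 y2; rewrite !E2 add0r qp addr0 subr0 in Ex x1 x2.
have -> : u (p1, p2) - u (q1, q2) - ((p1 - q1) * ua z + (p2 - q2) * ub z) =
    (ub (q1, q2 + x) - ub z) * (p2 - q2) + (ua (q1 + y, p2) - ua z) * (p1 - q1).
  rewrite !mulrBl -Ex -Ey; ring.
have h1 : `|ua (q1 + y, p2) - ua z| <= e.
  rewrite distrC; have [|_ []] := zd (q1 + y, p2); last by [].
  split=> //=; apply: (btw _ q1 (p1 - q1)); rewrite ?qp//.
    by rewrite addrC addKr.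
  by rewrite [X in `|X|](_ : _ = y - (p1 - q1))//; ring.
have h2 : `|ub (q1, q2 + x) - ub z| <= e.
  rewrite distrC; have [|_ []] := zd (q1, q2 + x); last by [].
  split=> //=; apply: (btw _ q2 (p2 - q2)); rewrite ?qp//.
    by rewrite addrC addKr.
  by rewrite [X in `|X|](_ : _ = x - (p2 - q2))//; ring.
apply: (le_trans (ler_normD _ _)); rewrite !normrM mulrDr addrC.
by apply: lerD; rewrite ler_wpM2r.
Qed.

(** The increment estimate with [e = 1] gives a Lipschitz bound at [z], with the constant [K]
    below. *)
Lemma partials_continuous D u ua ub z : open D -> partials_on D u ua ub ->
  D z -> {for z, continuous u}.
Proof.
move=> oD pu Dz; apply/cvgrPdist_le => e e0.
have [d d0 H] := partials_increment oD pu Dz ltr01.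
pose K := 1 + (`|ua z| + `|ub z|).
have K0 : 0 < K by rewrite ltr_wpDr// addr_ge0.
near=> p; have zp : ball z d p by near: p; exact: (nbhsx_ballx z).
have {}H := H z p (ballxx _ d0) zp.
have hm : `|z.1 - p.1| + `|z.2 - p.2| <= e / K.
  have [] : ball z (e / K / 2) p by near: p; apply: (nbhsx_ballx z); rewrite !divr_gt0.
  by rewrite /ball/= => h1 h2; rewrite [leRHS]splitr lerD// ltW.
rewrite -[u z - u p](subrK ((z.1 - p.1) * ua z + (z.2 - p.2) * ub z)).
apply: (le_trans (ler_normD _ _)); apply: (@le_trans _ _ (K * (`|z.1 - p.1| + `|z.2 - p.2|))).
  rewrite /K [leRHS]mulrDl; apply: lerD => //; apply: (le_trans (ler_normD _ _)).
  rewrite !normrM [leRHS]mulrDl !mulrDr.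
  have := mulr_ge0 (normr_ge0 (ua z)) (normr_ge0 (z.2 - p.2)).
  have := mulr_ge0 (normr_ge0 (ub z)) (normr_ge0 (z.1 - p.1)).
  lra.
by rewrite mulrC -ler_pdivlMr.
Unshelve. all: by end_near. Qed.

(** Chain rule along a curve that is only differentiable at [t]. The increment estimate replaces the
    quotient of [u] by the linear expression [l h] in the quotients of [g1] and [g2], which
    converges. *)
Lemma is_derive_curve D u ua ub (g1 g2 : R -> R) t d1 d2 : open D ->
  partials_on D u ua ub -> D (g1 t, g2 t) ->
  is_derive t (1 : R) g1 d1 -> is_derive t (1 : R) g2 d2 ->
  is_derive t (1 : R) (fun s => u (g1 s, g2 s))
    (d1 * ua (g1 t, g2 t) + d2 * ub (g1 t, g2 t)).
Proof.
move=> oD pu Dg dg1 dg2; set z := (g1 t, g2 t).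
have /is_deriveP c1 := dg1; have /is_deriveP c2 := dg2.
have k1 : {for t, continuous g1}.
  by apply/differentiable_continuous/derivable1_diffP; case: dg1.
have k2 : {for t, continuous g2}.
  by apply/differentiable_continuous/derivable1_diffP; case: dg2.
apply/is_deriveP/cvgrPdist_le => e e0.
(* Near 0 the quotients of [g1] and [g2] are at most [|d1| + 1] and [|d2| + 1] in absolute value, so
   [K] bounds their sum and the tolerance [e / K / 2] contributes at most [e / 2]. *)
pose K := `|d1| + `|d2| + 2.
have K0 : 0 < K by rewrite ltr_wpDl// addr_ge0.
have [d d0 H] := partials_increment oD pu Dg (divr_gt0 (divr_gt0 e0 K0) (ltr0Sn R 1)).
pose l (h : R) := (h^-1 *: (g1 (h *: 1 + t) - g1 t)) * ua z
   + (h^-1 *: (g2 (h *: 1 + t) - g2 t)) * ub z.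
have cl : l h @[h --> 0^'] --> d1 * ua z + d2 * ub z.
  by apply: cvgD; apply: cvgM => //; exact: cvg_cst.
have sh : (fun h : R => h *: 1 + t) h @[h --> 0^'] --> t.
  rewrite -[X in _ --> X]add0r; apply: cvgD; last exact: cvg_cst.
  rewrite -[X in _ --> X](scale0r (1 : R)).
  by apply: cvgZr_tmp; apply: cvg_within; exact: cvg_id.
have hz : \forall h \near 0^', ball z d (g1 (h *: 1 + t), g2 (h *: 1 + t)).
  apply: (sh [set s | ball z d (g1 s, g2 s)]).
  exact: (continuous_pair_at k1 k2 (nbhsx_ballx z d d0)).
near=> h.
have h0 : h != 0 by near: h; exact: nbhs_dnbhs_neq.
have m1 : `|h^-1 *: (g1 (h *: 1 + t) - g1 t)| <= `|d1| + 1.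
  rewrite -lerBlDl; apply: (le_trans (lerB_dist _ _)); rewrite distrC.
  by near: h; move/cvgrPdist_le : c1; apply.
have m2 : `|h^-1 *: (g2 (h *: 1 + t) - g2 t)| <= `|d2| + 1.
  rewrite -lerBlDl; apply: (le_trans (lerB_dist _ _)); rewrite distrC.
  by near: h; move/cvgrPdist_le : c2; apply.
have sE (x : R) : h^-1 *: x = h^-1 * x by [].
rewrite !sE in m1 m2.
have lh : `|d1 * ua z + d2 * ub z - l h| <= e / 2.
  by near: h; move/cvgrPdist_le : cl; apply; rewrite divr_gt0.
have zh : ball z d (g1 (h *: 1 + t), g2 (h *: 1 + t)) by near: h.
have {}H := H _ z zh (ballxx _ d0).
rewrite -[X in `|X|](subrKA (l h)) [leRHS]splitr.
set r := u _ - u z in H *.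
apply: (le_trans (ler_normD _ _)); apply: (lerD lh).
have -> : l h - h^-1 *: r = - (h^-1 * (r - ((g1 (h *: 1 + t) - g1 t) * ua z
    + (g2 (h *: 1 + t) - g2 t) * ub z))).
  by rewrite /l !sE; ring.
rewrite normrN normrM.
apply: (@le_trans _ _ (`|h^-1| * (e / K / 2 *
    (`|g1 (h *: 1 + t) - g1 t| + `|g2 (h *: 1 + t) - g2 t|)))).
  by rewrite ler_wpM2l.
rewrite mulrCA mulrDr -!normrM.
rewrite [leRHS](_ : _ = e / K / 2 * K); last by field; rewrite gt_eqF.
rewrite ler_wpM2l//; first by rewrite !divr_ge0// ltW.
by apply: (le_trans (lerD m1 m2)); rewrite /K; lra.
Unshelve. all: by end_near. Qed.

End PartialDerivatives.

(** * Regularity of holomorphic functions *)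

Section CauchyRiemann.
Variable R : realType.
Implicit Types (D : set (R * R)) (u v p q f g : R * R -> R) (z : R * R) (s t : R).

Definition circ z s t : R * R := (z.1 + s * cos t, z.2 + s * sin t).

Lemma is_derive_from_line (V W : normedModType R) (f : V -> W) (a v : V) df :
  is_derive (0 : R) (1 : R) (fun s => f (a + s *: v)) df -> is_derive a v f df.
Proof.
move/is_deriveP => h; apply/is_deriveP; apply: cvg_trans h; apply: near_eq_cvg.
near=> h; congr (_ *: (f _ - f _)).
  by rewrite addr0 [h *: 1]mulr1 addrC.
by rewrite scale0r addr0.
Unshelve. all: by end_near. Qed.

Lemma circ_ball z0 z s t r : ball z0 r z -> `|s| < r -> ball z0 (2 * r) (circ z s t).
Proof.
have bnd a (c : R) : `|c| <= 1 -> `|a| < r -> forall x y, ball x r y ->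
    ball x (2 * r) (y + a * c).
  move=> c1 ar x y; rewrite /ball/= => xy.
  rewrite opprD addrA; apply: (le_lt_trans (ler_normB _ _)).
  by rewrite mulr_natl mulr2n ltrD// (le_lt_trans _ ar)// normrM ler_piMr.
move=> [z01 z02] sr; split; apply: bnd => //.
  exact: cos_max.
exact: sin_max.
Qed.

Lemma continuous_circ_comp (T : topologicalType) D f (a : T -> R * R) (b c : T -> R) x :
  open D -> (forall z, D z -> {for z, continuous f}) ->
  {for x, continuous a} -> {for x, continuous b} -> {for x, continuous c} ->
  D (circ (a x) (b x) (c x)) ->
  {for x, continuous (fun y => f (circ (a y) (b y) (c y)))}.
Proof.
move=> oD cf ca cb cc Dx.
apply: (@continuous_comp _ _ _ (fun y => circ (a y) (b y) (c y)) f); last exact: cf.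
apply: continuous_pair_at; apply: cvgD.
- by apply: (continuous_comp ca); exact: cvg_fst.
- apply: cvgM; first exact: cb.
  apply: (continuous_comp cc); exact: continuous_cos.
- by apply: (continuous_comp ca); exact: cvg_snd.
- apply: cvgM; first exact: cb.
  apply: (continuous_comp cc); exact: continuous_sin.
Qed.

Lemma partials_on_ext D u ua ub ub' : open D -> (forall z, D z -> ub z = ub' z) ->
  partials_on D u ua ub -> partials_on D u ua ub'.
Proof.
move=> oD E h z Dz; have [h1 h2 h3 h4] := h z Dz; split => //; first by rewrite -E.
have {h4} : ub y @[y --> z] --> ub' z by rewrite -E.
apply: cvg_trans; apply: near_eq_cvg.
by apply: filterS (open_nbhs_nbhs (conj oD Dz)) => y; exact: E.
Qed.

Lemma circ_shift z s t (w : R * R) : circ (z + w) s t = circ z s t + w.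
Proof. by rewrite /circ /=; congr pair; rewrite /= addrAC. Qed.

(** The real part of the integral of [(f + i g) e^(-it)] over the circle: up to the factor [2 pi s],
    Cauchy's formula for the derivative at the centre. It is not divided by the length of the
    period. *)
Definition circ_mean f g z s : R :=
  cint (fun t => f (circ z s t) * cos t + g (circ z s t) * sin t).

Lemma continuous_circ_integrand (T : topologicalType) D f g (a : T -> R * R)
    (b c : T -> R) x :
  open D -> (forall z, D z -> {for z, continuous f}) ->
  (forall z, D z -> {for z, continuous g}) ->
  {for x, continuous a} -> {for x, continuous b} -> {for x, continuous c} ->
  D (circ (a x) (b x) (c x)) ->
  {for x, continuous (fun y => f (circ (a y) (b y) (c y)) * cos (c y)
     + g (circ (a y) (b y) (c y)) * sin (c y))}.
Proof.
move=> oD cf cg ca cb cc Dx; apply: cvgD; apply: cvgM.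
- exact: (continuous_circ_comp oD cf).
- apply: (continuous_comp cc); exact: continuous_cos.
- exact: (continuous_circ_comp oD cg).
- apply: (continuous_comp cc); exact: continuous_sin.
Qed.

(* [u + i v] is holomorphic on [D] with derivative [p + i q]. *)
Definition holo2 D u v p q :=
  partials_on D u p (fun z => - q z) /\ partials_on D v q p.

(** Multiplication of the function and of its derivative by [-i]. It lets results about the real
    part [p] of the derivative be applied to [q]. *)
Lemma holo2_rot D u v p q : holo2 D u v p q ->
  holo2 D v (fun z => - u z) q (fun z => - p z).
Proof.
have NN (k : R * R -> R) : (fun z => - - k z) = k.
  by apply/funext => z; rewrite opprK.
move=> [hu hv]; split; first by rewrite NN.
move=> z /hu[h1 h2 h3 h4]; split; [exact: is_deriveN| |exact: cvgN|].
  by rewrite -[q z]opprK; exact: is_deriveN.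
by rewrite -[q]NN; exact: cvgN.
Qed.

Lemma is_derive_affine (a b t : R) : is_derive t (1 : R) (fun t => a + t * b) b.
Proof.
apply: (is_derive_eq (is_deriveD (is_derive_cst a t (1 : R))
  (is_deriveM (is_derive_id t (1 : R)) (is_derive_cst b t (1 : R))))).
by rewrite scaler0 !add0r [_ *: _]mulr1.
Qed.

Lemma near_norm_lt (s r : R) : `|s| < r -> \forall y \near s, `|y| < r.
Proof.
move=> sr; have := @norm_continuous _ _ s; move/(_ [set y | y < r]) => H.
by apply: H; exact: lt_nbhsl.
Qed.

Lemma circ_mean_deriv_radius D u v p q z r : open D -> holo2 D u v p q ->
  (forall s t, `|s| < r -> D (circ z s t)) -> forall s, `|s| < r ->
  circ_mean u v z s = s * cint (fun t => p (circ z s t)) /\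
  is_derive s (1 : R) (circ_mean u v z) (cint (fun t => p (circ z s t))).
Proof.
move=> oD [hu hv] Dr s sr.
have cu y : D y -> {for y, continuous u} by exact: (partials_continuous oD hu).
have cv y : D y -> {for y, continuous v} by exact: (partials_continuous oD hv).
have cp y : D y -> {for y, continuous p} by move=> /hu[].
have cq y : D y -> {for y, continuous q} by move=> /hv[].
have cid t : {for t, continuous (id : R -> R)} by exact: cvg_id.
split.
  (* By the Cauchy-Riemann equations the terms in [q] cancel in the derivative of [w] and those in
     [p] add up to [- s p]; [w] takes the same value at both ends of the period. *)
  pose w t := u (circ z s t) * sin t - v (circ z s t) * cos t.
  have dw t : is_derive t (1 : R) w (u (circ z s t) * cos t + v (circ z s t) * sin t
      - s * p (circ z s t)).
    have dc : is_derive t (1 : R) (fun t => z.1 + s * cos t) (- (s * sin t)).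
      apply: (is_derive_eq (is_deriveD (is_derive_cst z.1 t 1)
        (is_deriveZ s (is_derive_cos t)))).
      by rewrite add0r -mulrN.
    have ds : is_derive t (1 : R) (fun t => z.2 + s * sin t) (s * cos t).
      apply: (is_derive_eq (is_deriveD (is_derive_cst z.2 t 1)
        (is_deriveZ s (is_derive_sin t)))).
      by rewrite add0r.
    have du := is_derive_curve (g1 := fun t => z.1 + s * cos t)
      (g2 := fun t => z.2 + s * sin t) oD hu (Dr s t sr) dc ds.
    have dv := is_derive_curve (g1 := fun t => z.1 + s * cos t)
      (g2 := fun t => z.2 + s * sin t) oD hv (Dr s t sr) dc ds.
    rewrite -/(circ z s t) in du dv.
    apply: (is_derive_eq (is_deriveB (is_deriveM du (is_derive_sin t))
      (is_deriveM dv (is_derive_cos t)))).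
    rewrite /GRing.scale/= -/(circ z s t).
    rewrite -[s * p _]mulr1 -(cos2Dsin2 t); ring.
  have cuv : continuous (fun t => u (circ z s t) * cos t + v (circ z s t) * sin t).
    move=> t; apply: (continuous_circ_integrand (a := fun=> z) (b := fun=> s) (c := id) oD cu cv);
      [exact: cvg_cst|exact: cvg_cst|exact: cvg_id|exact: Dr].
  have csp : continuous (fun t => p (circ z s t)).
    move=> t; apply: (continuous_circ_comp (a := fun=> z) (b := fun=> s) (c := id) oD cp);
      [exact: cvg_cst|exact: cvg_cst|exact: cvg_id|exact: Dr].
  have cssp : continuous (fun t => s * p (circ z s t)).
    by move=> t; apply: cvgM; [exact: cvg_cst|exact: csp].
  have := cint_FTC dw; rewrite cintB// cintZ// => /(_ _).
  rewrite /w /circ mulr_natl cos2pi sin2pi cos0 sin0 subrr => E.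
  by apply/eqP; rewrite -subr_eq0; apply/eqP/E => t; exact: cvgB (cuv t) (cssp t).
(* In the derivative along the radius the terms in [q] cancel again, and what is left is [p] times
   [cos^2 + sin^2]. *)
apply: (@is_derive_cint _ (fun y => u (circ z y.1 y.2) * cos y.2 + v (circ z y.1 y.2) * sin y.2)
  (fun y => p (circ z y.1 y.2)) s).
apply: filterS (near_norm_lt sr) => y yr t; have Dy := Dr y t yr; split.
- have du := is_derive_curve (g1 := fun y => z.1 + y * cos t)
    (g2 := fun y => z.2 + y * sin t) oD hu Dy (is_derive_affine _ _ _) (is_derive_affine _ _ _).
  have dv := is_derive_curve (g1 := fun y => z.1 + y * cos t)
    (g2 := fun y => z.2 + y * sin t) oD hv Dy (is_derive_affine _ _ _) (is_derive_affine _ _ _).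
  apply: (is_derive_eq (is_deriveD (is_deriveM du (is_derive_cst (cos t) y (1 : R)))
    (is_deriveM dv (is_derive_cst (sin t) y (1 : R))))).
  rewrite /GRing.scale/= -/(circ z y t) -[RHS]mulr1 -(cos2Dsin2 t); ring.
- apply: (@continuous_circ_integrand (R * R)%type D u v (fun=> z) (fun x => x.1)
    (fun x => x.2) (y, t) oD cu cv);
    [exact: cvg_cst|exact: cvg_fst|exact: cvg_snd|exact: Dy].
- apply: (@continuous_circ_comp (R * R)%type D p (fun=> z) (fun x => x.1)
    (fun x => x.2) (y, t) oD cp);
    [exact: cvg_cst|exact: cvg_fst|exact: cvg_snd|exact: Dy].
Qed.

Lemma circ_mean_value D u v p q z r s : open D -> holo2 D u v p q ->
  (forall s t, `|s| < r -> D (circ z s t)) -> 0 < s < r ->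
  circ_mean u v z s = s * (2 * pi * p z).
Proof.
move=> oD h Dr /andP[s0 sr].
have cp y : D y -> {for y, continuous p} by move=> /(h.1 _)[].
have H y : 0 <= y -> y < r -> `|y| < r by move=> y0 yr; rewrite ger0_norm.
have [-> _] := circ_mean_deriv_radius oD h Dr (H s (ltW s0) sr); congr (_ * _).
pose A y := cint (fun t => p (circ z y t)).
have cA y : `|y| < r -> {for y, continuous A}.
  move=> yr; apply: (@continuous_cint _ _ (fun y => p (circ z y.1 y.2))).
  apply: filterS (near_norm_lt yr) => x xr t.
  apply: (@continuous_circ_comp (R * R)%type D p (fun=> z) (fun x => x.1)
    (fun x => x.2) (x, t) oD cp);
    [exact: cvg_cst|exact: cvg_fst|exact: cvg_snd|exact: Dr].
have dA y : 0 < y -> y < r -> is_derive y (1 : R) A 0.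
  move=> y0 yr; have yr' := H y (ltW y0) yr.
  have [E dM] := circ_mean_deriv_radius oD h Dr yr'.
  have dV := is_deriveV (lt0r_neq0 y0) (is_derive_id y (1 : R)).
  (* [A] is differentiated through its expression as [circ_mean] over the radius, because nothing is
     known yet about derivatives of [p]. *)
  have : is_derive y (1 : R) (fun y => y^-1 * circ_mean u v z y) 0.
    apply: (is_derive_eq (is_deriveM dV dM)).
    rewrite /GRing.scale/= E; field; exact: lt0r_neq0.
  apply: near_eq_is_derive; near=> x.
  have x0 : 0 < x by near: x; exact: lt_nbhsr.
  have xr : `|x| < r by near: x; exact: near_norm_lt.
  have [-> _] := circ_mean_deriv_radius oD h Dr xr.
  by rewrite mulKf// gt_eqF.
(* The derivative is known for positive radii only; continuity of [A] at 0 brings in the centre,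
   where the circle degenerates to the point [z]. *)
have [||y _] := @MVT_segment R A (fun=> 0) 0 s (ltW s0).
- by move=> y /andP[y0 ys]; apply: dA => //; exact: lt_trans sr.
- apply: continuous_in_subspaceT => y; rewrite inE/= in_itv/= => /andP[y0 ys].
  by apply/cA/H => //; exact: le_lt_trans sr.
rewrite mul0r => /eqP; rewrite subr_eq0 => /eqP; rewrite /A => ->.
rewrite (_ : (fun t => _) = fun=> p z) ?cint_cst//.
by apply/funext => t; rewrite /circ !mul0r !addr0; case: z {Dr cA dA A}.
Unshelve. all: by end_near. Qed.

(** On the smaller ball [p] is [K u v], an integral over a circle of fixed radius [s < r] about the
    variable centre. The centre enters only through [u] and [v], whose partial derivatives are
    continuous, so differentiating [p] replaces [u] and [v] under the integral by their partial
    derivatives. *)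
Lemma holo2_deriv D u v p q z0 r : open D -> holo2 D u v p q ->
  0 < r -> ball z0 (2 * r) `<=` D ->
  exists p' q', holo2 (ball z0 r) p q p' q'.
Proof.
move=> oD h r0 Dr; pose s := r / 2; pose c := (2 * pi * s)^-1.
have s0 : 0 < s by rewrite divr_gt0.
have sr : s < r by rewrite /s; lra.
have Dz z : ball z0 r z -> forall s t, `|s| < r -> D (circ z s t).
  by move=> zr y t yr; apply: Dr; exact: circ_ball.
have Ds z t : ball z0 r z -> D (circ z s t).
  by move=> /Dz; apply; rewrite gtr0_norm.
have ob (z : R * R) (e : R) : open (ball z e) by exact: ball_open.
pose K f g z := c * circ_mean f g z s.
have cK f g z : (forall z, D z -> {for z, continuous f}) ->
    (forall z, D z -> {for z, continuous g}) -> ball z0 r z ->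
    {for z, continuous (K f g)}.
  move=> cf cg zr; apply: cvgM; first exact: cvg_cst.
  apply: (@continuous_cint _ _ (fun y =>
    f (circ y.1 s y.2) * cos y.2 + g (circ y.1 s y.2) * sin y.2)).
  apply: filterS (open_nbhs_nbhs (conj (ob z0 r) zr)) => y yr t.
  apply: (@continuous_circ_integrand (R * R * R)%type D f g (fun x => x.1) (fun=> s)
    (fun x => x.2) (y, t) oD cf cg);
    [exact: cvg_fst|exact: cvg_cst|exact: cvg_snd|exact: Ds].
have KN f g z : (forall z, D z -> {for z, continuous f}) ->
    (forall z, D z -> {for z, continuous g}) -> ball z0 r z ->
    K (fun z => - f z) (fun z => - g z) z = - K f g z.
  move=> cf cg zr; rewrite /K -mulrN -[- circ_mean _ _ _ _]mulN1r; congr (_ * _).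
  rewrite /circ_mean -cintZ.
    by congr cint; apply/funext => t; ring.
  move=> t; apply: (continuous_circ_integrand (a := fun=> z) (b := fun=> s) (c := id) oD cf cg);
    [exact: cvg_cst|exact: cvg_cst|exact: cvg_id|exact: Ds].
(* The real part of the derivative is enough: applied to the data multiplied by [-i], the same
   statement gives the partial derivatives of [q], up to the signs handled by [KN]. *)
suff H u1 v1 p1 q1 : holo2 D u1 v1 p1 q1 ->
    partials_on (ball z0 r) p1 (K p1 q1) (fun z => - K q1 (fun z => - p1 z) z).
  exists (K p q), (K q (fun z => - p z)); split; first exact: (H _ _ _ _ h).
  apply: partials_on_ext (H _ _ _ _ (holo2_rot h)) => // z zr.
  rewrite KN ?opprK// => y Dy; first by have [] := h.1 y Dy.
  by have [] := h.2 y Dy.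
move=> h1; have [hp hq] := h1.
have cp y : D y -> {for y, continuous p1} by move=> /hp[].
have cq y : D y -> {for y, continuous q1} by move=> /hq[].
have cNp y : D y -> {for y, continuous (fun z => - p1 z)} by move=> /cp ?; exact: cvgN.
have cu y : D y -> {for y, continuous u1} by exact: (partials_continuous oD hp).
have cv y : D y -> {for y, continuous v1} by exact: (partials_continuous oD hq).
have pK z : ball z0 r z -> K u1 v1 z = p1 z.
  move=> zr; rewrite /K (@circ_mean_value D _ _ _ _ _ _ _ oD h1 (Dz z zr)) ?s0//.
  have s1 : s != 0 by rewrite gt_eqF.
  rewrite /c (_ : s * _ = 2 * pi * s * p1 z); last by rewrite mulrCA !mulrA.
  by rewrite mulKf// mulf_neq0// gt_eqF// two_pi_gt0.
(* Both partial derivatives at once: [w] is the direction, [a] and [b] are the derivatives of [u1]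
   and [v1] along it. *)
have dK (w : R * R) (a b : R * R -> R) z : ball z0 r z ->
    (forall z, D z -> {for z, continuous a}) ->
    (forall z, D z -> {for z, continuous b}) ->
    (forall y, D y -> is_derive y w u1 (a y)) ->
    (forall y, D y -> is_derive y w v1 (b y)) -> is_derive z w p1 (K a b z).
  move=> zr ca cb da db; apply: (@near_eq_is_derive _ _ _ (K u1 v1)).
    by apply: filterS (open_nbhs_nbhs (conj (ob z0 r) zr)) => y; exact: pK.
  apply: is_derive_from_line.
  pose g (a b : R * R -> R) (y : R * R) := a (circ (z + y.1 *: w) s y.2) * cos y.2
    + b (circ (z + y.1 *: w) s y.2) * sin y.2.
  have cw : continuous (fun y : R => z + y *: w).
    by move=> y; apply: cvgD; [exact: cvg_cst|apply: cvgZr_tmp; exact: cvg_id].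
  have cw2 (y : R * R) : {for y, continuous (fun y : R * R => z + y.1 *: w)}.
    apply: (@continuous_comp _ _ _ fst (fun y : R => z + y *: w)); first exact: cvg_fst.
    exact: cw.
  have nw : \forall y \near (0 : R), ball z0 r (z + y *: w).
    apply: (cw 0 (ball z0 r)); rewrite scale0r addr0.
    exact: open_nbhs_nbhs (conj (ob z0 r) zr).
  rewrite (_ : K a b z = c * cint (fun t => g a b (0, t))); last first.
    by rewrite /K /circ_mean /g/= scale0r addr0.
  apply: (is_deriveZ c (@is_derive_cint _ (g u1 v1) (g a b) 0 _)).
  apply: filterS nw => y yr t; have Dy := Ds _ t yr; split.
  - rewrite circ_shift in Dy.
    have du := is_derive_line (da _ Dy); have dv := is_derive_line (db _ Dy).
    rewrite /g /=; under eq_fun do rewrite !circ_shift.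
    apply: (is_derive_eq (is_deriveD (is_deriveM du (is_derive_cst (cos t) y (1 : R)))
      (is_deriveM dv (is_derive_cst (sin t) y (1 : R))))).
    by rewrite circ_shift /GRing.scale/= !mulr0 !add0r ![_ * a _]mulrC ![_ * b _]mulrC.
  - apply: (@continuous_circ_integrand (R * R)%type D u1 v1 (fun x => z + x.1 *: w) (fun=> s)
      (fun x => x.2) (y, t) oD cu cv);
      [exact: cw2|exact: cvg_cst|exact: cvg_snd|exact: Dy].
  - apply: (@continuous_circ_integrand (R * R)%type D a b (fun x => z + x.1 *: w) (fun=> s)
      (fun x => x.2) (y, t) oD ca cb);
      [exact: cw2|exact: cvg_cst|exact: cvg_snd|exact: Dy].
move=> z zr; split.
- by apply: dK => // y; [case/hp|case/hq].
- rewrite -KN//; apply: dK => // y Dy.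
  + by apply: cvgN; exact: cq.
  + by apply: cvgN; exact: cNp.
  + by have [] := hp y Dy.
  + by rewrite opprK; have [] := hq y Dy.
- exact: cK.
- by apply: cvgN; exact: cK.
Qed.

End CauchyRiemann.

(** * Exponential series in H (x) C *)

Section CquatNorm.
Variable R : realType.
Implicit Types (x y : quat R) (p q : cquat R).

Lemma quat_coord_le x l : `|x ord0 l| <= `|x|.
Proof.
rewrite [leRHS]mx_normrE; exact: (le_bigmax _ (fun i : 'I_1 * 'I_4 => `|x i.1 i.2|) (ord0, l)).
Qed.

Lemma quat_norm_le x c : 0 <= c -> (forall l, `|x ord0 l| <= c) -> `|x| <= c.
Proof.
move=> c0 xc; rewrite [leLHS]mx_normrE; apply/bigmax_leP; split=> // -[i j] _ /=.
by rewrite (ord1 i).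
Qed.

Lemma cquat_normE p : `|p| = Num.max `|p.1| `|p.2|.
Proof. by []. Qed.

Lemma cquat_norm1_le p : `|p.1| <= `|p|.
Proof. by rewrite cquat_normE le_max lexx. Qed.

Lemma cquat_norm2_le p : `|p.2| <= `|p|.
Proof. by rewrite cquat_normE le_max lexx orbT. Qed.

(** The norm is the largest coordinate in absolute value, and each coordinate of a product is a
    signed sum of four products of coordinates. *)
Lemma quat_normM x y : `|x * y| <= 4 * (`|x| * `|y|).
Proof.
apply: quat_norm_le; first by rewrite !mulr_ge0.
have b (i j : 'I_4) : `|x ord0 i * y ord0 j| <= `|x| * `|y|.
  by rewrite normrM ler_pM// quat_coord_le.
have b4 (a1 a2 a3 a4 c : R) : `|a1| <= c -> `|a2| <= c -> `|a3| <= c -> `|a4| <= c ->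
    [/\ `|a1 - a2 - a3 - a4| <= 4 * c, `|a1 + a2 + a3 - a4| <= 4 * c,
        `|a1 - a2 + a3 + a4| <= 4 * c & `|a1 + a2 - a3 + a4| <= 4 * c].
  rewrite !ler_norml => /andP[? ?] /andP[? ?] /andP[? ?] /andP[? ?].
  by split; apply/andP; split; lra.
pose o0 := @Ordinal 4 0 isT; pose o1 := @Ordinal 4 1 isT.
pose o2 := @Ordinal 4 2 isT; pose o3 := @Ordinal 4 3 isT.
move=> [[|[|[|[|//]]]] il]; rewrite [x * y]/(qmul x y) mxE/=.
- by case: (b4 _ _ _ _ _ (b o0 o0) (b o1 o1) (b o2 o2) (b o3 o3)) => h _ _ _; exact: h.
- by case: (b4 _ _ _ _ _ (b o0 o1) (b o1 o0) (b o2 o3) (b o3 o2)) => _ h _ _; exact: h.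
- by case: (b4 _ _ _ _ _ (b o0 o2) (b o1 o3) (b o2 o0) (b o3 o1)) => _ _ h _; exact: h.
- by case: (b4 _ _ _ _ _ (b o0 o3) (b o1 o2) (b o2 o1) (b o3 o0)) => _ _ _ h; exact: h.
Qed.

(** Each component of the product is made of two quaternionic products, hence twice the previous
    constant. *)
Lemma cquat_normM p q : `|p * q| <= 8 * (`|p| * `|q|).
Proof.
have b x y : `|x| <= `|p| -> `|y| <= `|q| -> `|x * y| <= 4 * (`|p| * `|q|).
  by move=> xp yq; apply: (le_trans (quat_normM x y)); rewrite ler_wpM2l// ler_pM.
have e8 : 8 * (`|p| * `|q|) = 4 * (`|p| * `|q|) + 4 * (`|p| * `|q|) by ring.
have := cquat_norm1_le p; have := cquat_norm2_le p.
have := cquat_norm1_le q; have := cquat_norm2_le q => q2 q1 p2 p1.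
rewrite e8 cquat_normE ge_max; apply/andP; split.
  by apply: (le_trans (ler_normB _ _)); apply: lerD; apply: b.
by apply: (le_trans (ler_normD _ _)); apply: lerD; apply: b.
Qed.

(** Expand [m (f t) (g t) - m a b] around [(a, b)] into three terms, each containing [f t - a] or
    [g t - b]. This covers the products of both algebras, whose norms are submultiplicative only up
    to a constant. *)
Lemma cvg_bounded_bilinear (U V W : normedModType R) (m : U -> V -> W) (K : R)
    (T : Type) (F : set_system T) {FF : Filter F} (f : T -> U) (g : T -> V) a b :
  (forall u1 u2 v, m (u1 + u2) v = m u1 v + m u2 v) ->
  (forall u v1 v2, m u (v1 + v2) = m u v1 + m u v2) ->
  (forall u v, `|m u v| <= K * (`|u| * `|v|)) ->
  f t @[t --> F] --> a -> g t @[t --> F] --> b -> m (f t) (g t) @[t --> F] --> m a b.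
Proof.
move=> mDl mDr mb fa gb; apply/subr_cvg0/norm_cvg0P.
have f0 : `|f t - a| @[t --> F] --> 0 by apply/norm_cvg0P/subr_cvg0.
have g0 : `|g t - b| @[t --> F] --> 0 by apply/norm_cvg0P/subr_cvg0.
apply: (squeeze_cvgr (f := fun=> 0) (h := fun t => K * (`|f t - a| * `|g t - b|)
  + K * (`|f t - a| * `|b|) + K * (`|a| * `|g t - b|))).
- near=> t; rewrite normr_ge0/=.
  rewrite (_ : m (f t) (g t) - m a b = m (f t - a) (g t - b) + m (f t - a) b + m a (g t - b)).
    apply: (le_trans (ler_normD _ _)); apply: lerD; last exact: mb.
    by apply: (le_trans (ler_normD _ _)); apply: lerD; exact: mb.
  have e1 : m (f t) (g t) = m (f t - a) (g t) + m a (g t) by rewrite -mDl subrK.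
  have e2 : m a (g t) = m a (g t - b) + m a b by rewrite -mDr subrK.
  by rewrite -mDr subrK e1 e2 addrA addrK.
- exact: cvg_cst.
- rewrite -[X in _ --> X](_ : K * (0 * 0) + K * (0 * `|b|) + K * (`|a| * 0) = 0).
    by apply: cvgD; [apply: cvgD|]; (apply: cvgM; first exact: cvg_cst);
      (apply: cvgM; [exact: f0 || exact: cvg_cst|exact: g0 || exact: cvg_cst]).
  by rewrite mul0r !mulr0 mul0r !mulr0 !addr0.
Unshelve. all: by end_near. Qed.

Lemma cvg_cquatM (T : Type) (F : set_system T) {FF : Filter F} (f g : T -> cquat R) p q :
  f t @[t --> F] --> p -> g t @[t --> F] --> q -> f t * g t @[t --> F] --> p * q.
Proof.
move=> fp gq; apply: (@cvg_bounded_bilinear (cquat R) (cquat R) (cquat R)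
  *%R 8 T F FF f g p q _ _ _ fp gq).
- by move=> u1 u2 v; exact: mulrDl.
- by move=> u1 u2 v; exact: mulrDr.
- exact: cquat_normM.
Qed.

Lemma cvg_quatM (T : Type) (F : set_system T) {FF : Filter F} (f g : T -> quat R) x y :
  f t @[t --> F] --> x -> g t @[t --> F] --> y -> f t * g t @[t --> F] --> x * y.
Proof.
move=> fx gy; apply: (@cvg_bounded_bilinear (quat R) (quat R) (quat R)
  *%R 4 T F FF f g x y _ _ _ fx gy).
- by move=> u1 u2 v; exact: mulrDl.
- by move=> u1 u2 v; exact: mulrDr.
- exact: quat_normM.
Qed.

Lemma cvg_cquatP (T : Type) (F : set_system T) {FF : Filter F} (f : T -> cquat R) p :
  f t @[t --> F] --> p <->
  forall l, (f t).1 ord0 l @[t --> F] --> p.1 ord0 l /\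
            (f t).2 ord0 l @[t --> F] --> p.2 ord0 l.
Proof.
split=> [fp l|fp].
  split; apply/cvgrPdist_lt => e e0; move/cvgrPdist_lt : fp => /(_ e e0);
      apply: filterS => t; apply: le_lt_trans.
    have := quat_coord_le (p - f t).1 l; rewrite !mxE => h.
    by apply: (le_trans h); exact: cquat_norm1_le.
  have := quat_coord_le (p - f t).2 l; rewrite !mxE => h.
  by apply: (le_trans h); exact: cquat_norm2_le.
apply/cvgrPdist_le => e e0.
have h1 : \forall t \near F, forall l, `|(p - f t).1 ord0 l| <= e.
  apply: filter_forall => l; have [/cvgrPdist_le/(_ e e0) h _] := fp l.
  by apply: filterS h => t; rewrite !mxE.
have h2 : \forall t \near F, forall l, `|(p - f t).2 ord0 l| <= e.
  apply: filter_forall => l; have [_ /cvgrPdist_le/(_ e e0) h] := fp l.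
  by apply: filterS h => t; rewrite !mxE.
near=> t; rewrite cquat_normE ge_max; apply/andP; split.
  by apply: quat_norm_le; [exact: ltW|near: t].
by apply: quat_norm_le; [exact: ltW|near: t].
Unshelve. all: by end_near. Qed.

End CquatNorm.

(** * Convergence and second order remainder *)

Section EntireSeries.
Variable R : realType.
Implicit Types (z w : R * R) (p q : cquat R) (c d : nat -> cquat R).

Lemma cqscalerAl (a : R) p q : a *: (p * q) = (a *: p : cquat R) * q.
Proof.
rewrite -[LHS]/(a *: (p.1 * q.1 - p.2 * q.2), a *: (p.1 * q.2 + p.2 * q.1)).
by apply: (congr2 pair); rewrite /= ?scalerBr ?scalerDr !scalerAl.
Qed.

Lemma cqscalerAr (a : R) p q : a *: (p * q) = p * (a *: q).
Proof.
rewrite -[LHS]/(a *: (p.1 * q.1 - p.2 * q.2), a *: (p.1 * q.2 + p.2 * q.1)).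
by apply: (congr2 pair); rewrite /= ?scalerBr ?scalerDr !scalerAr.
Qed.

(** The central copy of C in H (x) C: [alpha + i beta] goes to [alpha + iota beta]. *)
Definition cz z : cquat R := (z.1%:A, z.2%:A).

Lemma czC z p : cz z * p = p * cz z.
Proof.
rewrite /cz -[LHS]/(z.1%:A * p.1 - z.2%:A * p.2, z.1%:A * p.2 + z.2%:A * p.1).
rewrite -[RHS]/(p.1 * z.1%:A - p.2 * z.2%:A, p.1 * z.2%:A + p.2 * z.1%:A).
by rewrite -!scalerAl -!scalerAr !mul1r !mulr1 addrC [in X in (_, X)]addrC.
Qed.

Lemma czD z w : cz (z + w) = cz z + cz w.
Proof. by rewrite /cz !scalerDl. Qed.

Lemma czZ (a : R) z : cz (a *: z) = a *: cz z.
Proof. by rewrite /cz -[RHS]/(a *: z.1%:A, a *: z.2%:A) !scalerA. Qed.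

Lemma cz1 : cz (1, 0) = 1.
Proof. by rewrite /cz /= scale1r scale0r. Qed.

Lemma cz_iota : cz (0, 1) = iota_unit.
Proof. by rewrite /cz /= scale1r scale0r. Qed.

Lemma norm_cquat1 : `|1 : cquat R| <= 1.
Proof.
rewrite cquat_normE ge_max /= normr0 ler01 andbT.
apply: quat_norm_le => // -[[|[|[|[|//]]]] il]; rewrite mxE/= ?normr0 ?normr1//.
Qed.

Lemma norm_cz z : `|cz z| <= `|z|.
Proof.
have b (a : R) : `|a%:A : quat R| <= `|a|.
  by rewrite normrZ ler_piMr//; have := norm_cquat1; rewrite cquat_normE ge_max => /andP[].
rewrite cquat_normE ge_max; apply/andP; split; apply: (le_trans (b _)).
  by rewrite [leRHS]/(Num.max _ _) le_max lexx.
by rewrite [leRHS]/(Num.max _ _) le_max lexx orbT.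
Qed.

(** The cofactor of [y^2] in the expansion of [(x + y)^n] around [x], for commuting [x] and [y]. At
    [m = 0] the truncated [m.-1] is harmless, its term being taken 0 times. *)
Fixpoint pow_rem (A : pzRingType) (x y : A) n : A :=
  if n is m.+1 then (x + y) * pow_rem x y m + x ^+ m.-1 *+ m else 0.

Lemma exprD_rem (A : pzRingType) (x y : A) n : GRing.comm x y ->
  (x + y) ^+ n = x ^+ n + y * x ^+ n.-1 *+ n + y * (y * pow_rem x y n).
Proof.
move=> xy; elim: n => [|n IH]; first by rewrite !expr0 mulr0n !mulr0 !addr0.
have e : x * (y * x ^+ n.-1 *+ n) = y * x ^+ n *+ n.
  case: n {IH} => [|n]; first by rewrite !mulr0n mulr0.
  by rewrite mulrnAr mulrA xy -mulrA -exprS.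
have e2 : (x + y) * (y * (y * pow_rem x y n)) = y * (y * ((x + y) * pow_rem x y n)).
  have cxy : GRing.comm (x + y) y by apply: commr_sym; apply: commrD => //; exact: commr_sym.
  by rewrite mulrA cxy -mulrA [(x + y) * (y * _)]mulrA cxy -mulrA.
rewrite exprS IH 2!mulrDr e2 [(x + y) * x ^+ n]mulrDl -exprS.
rewrite [(x + y) * (y * _ *+ n)]mulrDl e /= [y * (_ + x ^+ n.-1 *+ n)]mulrDr.
rewrite [in RHS]mulrDr [y * x ^+ n *+ n.+1]mulrS.
rewrite -!addrA; congr (_ + (_ + (_ + _))).
by rewrite addrC; congr (_ + _); rewrite !mulrnAr.
Qed.

(** The comparison test is applied to each of the eight real coordinates, and the limit is assembled
    from their limits. *)
Lemma cquat_series_cvg (u : nat -> cquat R) (b : R^nat) :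
  (forall n, `|u n| <= b n) -> cvgn (series b) -> cvgn (series u).
Proof.
move=> ub cb.
have coord (f : cquat R -> R) : (forall p q, f (p + q) = f p + f q) -> f 0 = 0 ->
    (forall p, `|f p| <= `|p|) -> cvgn (fun n => f (series u n)).
  move=> fD f0 fb.
  have -> : (fun n => f (series u n)) = series (fun n => f (u n)).
    by apply/funext => n; rewrite /series/= (big_morph f fD f0).
  apply: normed_cvg; apply: series_le_cvg cb => n //=.
  - by apply: le_trans (ub n).
  - exact: le_trans (fb _) (ub n).
have c1 l : cvgn (fun n => (series u n).1 ord0 l).
  apply: (coord (fun p => p.1 ord0 l)); [by move=> p q; rewrite mxE|by rewrite mxE|].
  by move=> p; apply: le_trans (cquat_norm1_le p); exact: quat_coord_le.
have c2 l : cvgn (fun n => (series u n).2 ord0 l).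
  apply: (coord (fun p => p.2 ord0 l)); [by move=> p q; rewrite mxE|by rewrite mxE|].
  by move=> p; apply: le_trans (cquat_norm2_le p); exact: quat_coord_le.
pose a : cquat R := (\row_l limn (fun n => (series u n).1 ord0 l),
  \row_l limn (fun n => (series u n).2 ord0 l)).
apply/cvg_ex; exists a; apply/cvg_cquatP => l; rewrite !mxE.
by split; [exact: c1|exact: c2].
Qed.

(** With the factorial kept apart from [c], differentiation of the sum is a shift of [c], and
    geometric growth of [c] makes the sum entire. Coefficients stand on the right, so right
    multiplication by a constant acts on them. *)
Definition exp_term c z n : cquat R := (n`!%:R : R)^-1 *: (cz z ^+ n * c n).

Definition exp_sum c z : cquat R := limn (series (exp_term c z)).

Definition geometric_growth c := exists C K, [/\ 0 <= C, 0 <= K & forall n, `|c n| <= C * K ^+ n].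

Lemma norm_expr_le p (r : R) n : 1 <= r -> 8 * `|p| <= r -> `|p ^+ n| <= r ^+ n.
Proof.
move=> r1 pr; elim: n => [|n IH]; first by rewrite !expr0 norm_cquat1.
rewrite !exprS; apply: (le_trans (cquat_normM _ _)); rewrite mulrA.
by apply: ler_pM => //; rewrite mulr_ge0.
Qed.

(** By induction: both summands of the recursion are at most [r (4 r)^n], the second one because
    [n <= 4^n] and [1 <= r]. The factor 8 in the hypotheses absorbs the constant of [cquat_normM] at
    each multiplication. *)
Lemma norm_pow_rem_le p q (r : R) n : 1 <= r -> 8 * `|p| <= r -> 8 * `|p + q| <= r ->
  `|pow_rem p q n| <= (4 * r) ^+ n.
Proof.
move=> r1 pr qr; have r0 : 0 <= r by rewrite (le_trans _ r1).
have nb m : (m%:R : R) <= 4 ^+ m by rewrite -natrX ler_nat ltnW// ltn_expl.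
elim: n => [|n IH]; first by rewrite /= normr0 expr0.
rewrite /=; apply: (le_trans (ler_normD _ _)).
apply: (@le_trans _ _ (r * (4 * r) ^+ n + r * (4 * r) ^+ n)); last first.
  rewrite -mulrDl exprS; apply: ler_wpM2r; first by rewrite exprn_ge0// mulr_ge0.
  by move: r0; lra.
apply: lerD.
  apply: (le_trans (cquat_normM _ _)); rewrite mulrA.
  by apply: ler_pM => //; rewrite mulr_ge0.
apply: (@le_trans _ _ (r ^+ n * n%:R)).
  rewrite -[leLHS]/(`|_ *+ n : cquat R|) normrMn -[leLHS]mulr_natr; apply: ler_wpM2r => //.
  apply: (le_trans (norm_expr_le _ r1 pr)).
  by apply: ler_weXn2l => //; exact: leq_pred.
rewrite exprMn mulrC -[leLHS]mul1r; apply: ler_pM => //.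
  by rewrite mulr_ge0// exprn_ge0.
by apply: ler_wpM2r; rewrite ?exprn_ge0.
Qed.

Lemma norm_exp_coeff_le c C K (r : R) n p : (forall n, `|c n| <= C * K ^+ n) ->
  `|p| <= r ^+ n -> `|(n`!%:R : R)^-1 *: (p * c n)| <= 8 * C * exp_coeff (r * K) n.
Proof.
move=> cCK pr; rewrite normrZ ger0_norm ?invr_ge0// /exp_coeff/= mulrC.
rewrite mulrA ler_wpM2r ?invr_ge0//; apply: (le_trans (cquat_normM _ _)).
rewrite -mulrA ler_wpM2l// exprMn mulrCA; exact: ler_pM.
Qed.

Lemma cvg_exp_sum c z : geometric_growth c -> series (exp_term c z) @ \oo --> exp_sum c z.
Proof.
move=> [C [K [C0 K0 cCK]]]; pose r := 1 + 8 * `|cz z|.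
have b n : `|exp_term c z n| <= 8 * C * exp_coeff (r * K) n.
  have := normr_ge0 (cz z) => z0.
  by apply: norm_exp_coeff_le cCK _; apply: norm_expr_le; rewrite /r; lra.
have h := cquat_series_cvg b; apply: h.
have -> : series (fun n => 8 * C * exp_coeff (r * K) n) = (8 * C) \*: series (exp_coeff (r * K)).
  by apply/funext => n; rewrite /series/= -mulr_sumr.
by apply: is_cvgZr; exact: is_cvg_series_exp_coeff.
Qed.

Lemma exp_sum_eq c z p : series (exp_term c z) @ \oo --> p ->
  exp_sum c z = p.
Proof. by move=> h; exact: cvg_lim. Qed.

Definition shift_seq c n := c n.+1.

Lemma geometric_growth_shift c : geometric_growth c -> geometric_growth (shift_seq c).
Proof.
move=> [C [K [C0 K0 cCK]]]; exists (C * K), K; split=> // [|n]; first by rewrite mulr_ge0.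
by rewrite -mulrA -exprS; exact: cCK.
Qed.

(** Expand each power of [z + w] to second order. The remainders have the common factor [|w|^2] and
    are dominated by an exponential series independent of [w] in the ball, so this one estimate
    yields both continuity and the derivative. *)
Lemma exp_sum_remainder c z (r : R) : geometric_growth c -> 0 <= r ->
  exists2 B, 0 <= B & forall w, `|w| <= r ->
  `|exp_sum c (z + w) - exp_sum c z - cz w * exp_sum (shift_seq c) z| <= B * `|w| ^+ 2.
Proof.
move=> gc r0; have [C [K [C0 K0 cCK]]] := gc.
pose p := 1 + 8 * (`|z| + r); pose e := C * expR (4 * p * K).
have e0 : 0 <= e by rewrite mulr_ge0// expR_ge0.
(* Three products occur in each remainder term [v n], each costing a factor 8. *)
exists (8 * (8 * (8 * e))); first by rewrite !mulr_ge0.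
move=> w wr; have := norm_cz z; have := norm_cz w => bw bz.
have p1 : 1 <= p by rewrite /p lerDl mulr_ge0// addr_ge0.
have pz : 8 * `|cz z| <= p by rewrite /p; lra.
have pzw : 8 * `|cz z + cz w| <= p.
  by have := ler_normD (cz z) (cz w); rewrite /p; lra.
(* The derivative of the term of index [n + 1] is the term of index [n] of the shifted series, hence
   partial sums of different lengths. *)
pose S n := series (exp_term c (z + w)) n.+1 - series (exp_term c z) n.+1 -
  cz w * series (exp_term (shift_seq c) z) n.
have cS : S n @[n --> \oo] -->
    exp_sum c (z + w) - exp_sum c z - cz w * exp_sum (shift_seq c) z.
  apply: cvgB.
    by apply: cvgB; rewrite (cvg_shiftS (series _)); exact: cvg_exp_sum.
  apply: cvg_cquatM; first exact: cvg_cst.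
  exact/cvg_exp_sum/geometric_growth_shift.
pose v n : cquat R := (n`!%:R : R)^-1 *:
    (cz w * (cz w * (pow_rem (cz z) (cz w) n * c n))).
have zw : GRing.comm (cz z) (cz w) by exact: czC.
have tE n : exp_term c (z + w) n.+1 - exp_term c z n.+1 -
    cz w * exp_term (shift_seq c) z n = v n.+1.
  (* The factor [n + 1] of the linear term turns [(n + 1)!] into [n!]. *)
  have Y : (n.+1`!%:R : R)^-1 *: ((cz w * cz z ^+ n *+ n.+1) * c n.+1) =
      cz w * ((n`!%:R : R)^-1 *: (cz z ^+ n * c n.+1)).
    rewrite -cqscalerAr mulrnAl -mulrA -scalerMnr scalerMnl -[_^-1 *+ _]mulr_natr factS natrM invfM.
    by rewrite mulrAC mulVf ?mul1r// pnatr_eq0.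
  rewrite /exp_term czD (exprD_rem _ zw) !mulrDl !scalerDr Y /v.
  have re (V : zmodType) (a b d : V) : a + b + d - a - b = d.
    by rewrite [a + b + d]addrC -addrA -opprD addrK.
  by rewrite re -2!mulrA.
have SE n : S n = series v n.+1.
  rewrite /S; elim: n => [|n IH].
    rewrite /series/= !big_nat1 big_geq// mulr0 subr0 /exp_term !expr0 subrr.
    by rewrite /v mul0r !mulr0 scaler0.
  have sS (u : nat -> cquat R) m : series u m.+1 = series u m + u m.
    by rewrite /series/= big_nat_recr.
  rewrite !(sS _ n.+1) [series (exp_term (shift_seq c) z) n.+1]sS -IH -tE mulrDr.
  have re (V : zmodType) (a1 a2 b1 b2 d1 d2 : V) :
      (a1 + a2) - (b1 + b2) - (d1 + d2) = (a1 - b1 - d1) + (a2 - b2 - d2).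
    by rewrite [- (b1 + b2)]opprD [a1 + a2 + _]addrACA [- (d1 + d2)]opprD [LHS]addrACA.
  exact: re.
have vb n : `|v n| <= 8 * (8 * (8 * (C * exp_coeff (4 * p * K) n))) * `|w| ^+ 2.
  have q := norm_pow_rem_le n p1 pz pzw.
  have nM (a : R) (x y : cquat R) b : `|x| <= a -> `|y| <= b -> `|x * y| <= 8 * (a * b).
    by move=> xa yb; apply: (le_trans (cquat_normM _ _)); rewrite ler_wpM2l// ler_pM.
  have := nM _ _ _ _ bw (nM _ _ _ _ bw (nM _ _ _ _ q (cCK n))) => h.
  rewrite /v normrZ ger0_norm ?invr_ge0//.
  apply: (le_trans (ler_wpM2l _ h)); first by rewrite invr_ge0.
  rewrite /exp_coeff /= [(_ * K) ^+ n]exprMn le_eqVlt; apply/orP; left; apply/eqP; ring.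
have Sb n : `|S n| <= 8 * (8 * (8 * e)) * `|w| ^+ 2.
  rewrite SE; apply: (le_trans (ler_norm_sum _ _ _)).
  apply: (le_trans (ler_sum _ (fun n _ => vb n))); rewrite -mulr_suml.
  apply: ler_wpM2r => //; rewrite -!mulr_sumr !ler_wpM2l// /e.
  apply: nondecreasing_cvgn_le; last exact: is_cvg_series_exp_coeff.
  apply: nondecreasing_series => m _ _; rewrite /exp_coeff /=.
  by rewrite divr_ge0// exprn_ge0// mulr_ge0// mulr_ge0// (le_trans _ p1).
rewrite -(cvg_lim _ (cvg_norm cS))//; apply: limr_le.
  by apply/cvg_ex; eexists; exact: (cvg_norm cS).
by near=> n; exact: Sb.
Unshelve. all: by end_near. Qed.

End EntireSeries.

(** * Derivatives, symmetries and evaluation of the series *)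

Section EntireSeriesProperties.
Variable R : realType.
Implicit Types (z w v : R * R) (p q : cquat R) (c d : nat -> cquat R).

Lemma is_derive_exp_sum c z v : geometric_growth c ->
  is_derive z v (exp_sum c) (cz v * exp_sum (shift_seq c) z).
Proof.
move=> gc; apply/is_deriveP/cvgrPdist_le => e e0.
(* The ball of radius [|v|] contains every increment [h *: v] with [|h| <= 1]. *)
have [B B0 H] := @exp_sum_remainder _ c z `|v| gc (normr_ge0 v).
pose K := B * `|v| ^+ 2 + 1.
have K0 : 0 < K by rewrite ltr_wpDl// mulr_ge0// exprn_ge0.
near=> h.
have h0 : h != 0 by near: h; exact: nbhs_dnbhs_neq.
have h1 : `|h| <= 1 by near: h; apply: dnbhs0_le.
have he : `|h| <= e / K by near: h; apply: dnbhs0_le; rewrite divr_gt0.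
have /H : `|h *: v| <= `|v| by rewrite normrZ ler_piMl.
rewrite normrZ exprMn => {}H.
have -> : cz v * exp_sum (shift_seq c) z - h^-1 *: (exp_sum c (h *: v + z) - exp_sum c z) =
   - (h^-1 *: (exp_sum c (z + h *: v) - exp_sum c z - cz (h *: v) * exp_sum (shift_seq c) z)).
  rewrite [h *: v + z]addrC [in RHS]scalerBr opprB; congr (_ - _).
  by rewrite czZ -cqscalerAl scalerA mulVf// scale1r.
rewrite normrN normrZ normfV.
apply: (@le_trans _ _ (`|h|^-1 * (B * (`|h| ^+ 2 * `|v| ^+ 2)))).
  by rewrite ler_wpM2l// invr_ge0.
have -> : `|h|^-1 * (B * (`|h| ^+ 2 * `|v| ^+ 2)) = `|h| * (B * `|v| ^+ 2).
  by field; rewrite normr_eq0.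
apply: (@le_trans _ _ (e / K * K)); last by rewrite divfK// gt_eqF.
apply: ler_pM => //; first by rewrite mulr_ge0// exprn_ge0.
by rewrite /K lerDl.
Unshelve. all: by end_near. Qed.

Lemma continuous_exp_sum c z : geometric_growth c -> {for z, continuous (exp_sum c)}.
Proof.
move=> gc; apply/cvgrPdist_le => e e0.
have [B B0 H] := @exp_sum_remainder _ c z 1 gc ler01.
pose K := 8 * `|exp_sum (shift_seq c) z| + B + 1.
have K0 : 0 < K by rewrite ltr_wpDl// addr_ge0// mulr_ge0.
near=> y; pose w := y - z.
have w1 : `|w| <= 1 by rewrite /w distrC; near: y; exact: cvgr_dist_le.
have we : `|w| <= e / K.
  by rewrite /w distrC; near: y; apply: cvgr_dist_le => //; rewrite divr_gt0.
have yE : y = z + w by rewrite /w addrC subrK.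
rewrite distrC yE -[X in `|X|](subrK (cz w * exp_sum (shift_seq c) z)).
apply: (le_trans (ler_normD _ _)).
apply: (@le_trans _ _ (e / K * K)); last by rewrite divfK// gt_eqF.
apply: (@le_trans _ _ (`|w| * K)); last by rewrite ler_wpM2r// ltW.
have h1 := H w w1; have h2 := cquat_normM (cz w) (exp_sum (shift_seq c) z).
have h3 : 8 * (`|cz w| * `|exp_sum (shift_seq c) z|) <= 8 * (`|w| * `|exp_sum (shift_seq c) z|).
  by rewrite ler_wpM2l// ler_wpM2r// norm_cz.
have h4 : B * `|w| ^+ 2 <= B * `|w|.
  by rewrite ler_wpM2l// expr2 ler_piMr.
rewrite /K !mulrDr; apply: (le_trans (lerD h1 (le_trans h2 h3))).
by move: h4 (normr_ge0 w); lra.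
Unshelve. all: by end_near. Qed.

(** As the shift is the derivative, a linear recursion between coefficients becomes a linear
    differential equation between sums. *)
Lemma exp_sum_shift_rec c d (m : cquat R) z : geometric_growth c -> geometric_growth d ->
  (forall n, c n.+1 = d n + c n * m) ->
  exp_sum (shift_seq c) z = exp_sum d z + exp_sum c z * m.
Proof.
move=> gc gd E; apply: exp_sum_eq.
have -> : series (exp_term (shift_seq c) z) =
    (fun n => series (exp_term d z) n + series (exp_term c z) n * m).
  apply/funext => n; rewrite /series/= mulr_suml -big_split; apply: eq_bigr => i _.
  by rewrite /exp_term /shift_seq E mulrDr scalerDr -cqscalerAl mulrA.
apply: cvgD; first exact: cvg_exp_sum.
by apply: cvg_cquatM; [exact: cvg_exp_sum|exact: cvg_cst].
Qed.

Lemma exp_sum_comm c (m : cquat R) z : geometric_growth c ->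
  (forall n, c n * m = m * c n) -> exp_sum c z * m = m * exp_sum c z.
Proof.
move=> gc E.
have h1 : series (exp_term c z) n * m @[n --> \oo] --> exp_sum c z * m.
  by apply: cvg_cquatM; [exact: cvg_exp_sum|exact: cvg_cst].
have h2 : series (exp_term c z) n * m @[n --> \oo] --> m * exp_sum c z.
  have -> : (fun n => series (exp_term c z) n * m) = (fun n => m * series (exp_term c z) n).
    apply/funext => n; rewrite /series/= mulr_suml mulr_sumr; apply: eq_bigr => i _.
    have cm : cz z ^+ i * m = m * cz z ^+ i.
      elim: i => [|i IH]; first by rewrite expr0 mul1r mulr1.
      by rewrite exprS -mulrA IH mulrA czC mulrA.
    by rewrite /exp_term -cqscalerAl -cqscalerAr -mulrA E mulrA cm mulrA.
  by apply: cvg_cquatM; [exact: cvg_cst|exact: cvg_exp_sum].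
by rewrite -(cvg_lim _ h1)// -(cvg_lim _ h2).
Qed.

Lemma exp_sum0 c : geometric_growth c -> exp_sum c 0 = c 0%N.
Proof.
move=> gc; apply: exp_sum_eq; rewrite -(cvg_shiftS (series _)).
have -> : (fun n => series (exp_term c 0) n.+1) = (fun=> c 0%N); last exact: cvg_cst.
apply/funext => n; rewrite /series/= big_nat_recl// big1 ?addr0 => [|i _].
  by rewrite /exp_term expr0 mul1r fact0 invr1 scale1r.
by rewrite /exp_term /cz /= !scale0r exprS mul0r mul0r scaler0.
Qed.

Lemma cvg_cquat1 (T : Type) (F : set_system T) {FF : Filter F} (f : T -> cquat R) p :
  f x @[x --> F] --> p -> (f x).1 @[x --> F] --> p.1.
Proof. by case: p => a b h; apply: (cvg_comp _ _ h cvg_fst). Qed.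

Lemma cvg_cquat2 (T : Type) (F : set_system T) {FF : Filter F} (f : T -> cquat R) p :
  f x @[x --> F] --> p -> (f x).2 @[x --> F] --> p.2.
Proof. by case: p => a b h; apply: (cvg_comp _ _ h cvg_snd). Qed.

Lemma cqconjM p q : cqconj (p * q) = cqconj p * cqconj q.
Proof.
rewrite -[RHS]/((p.1 * q.1 - (- p.2) * (- q.2), p.1 * (- q.2) + (- p.2) * q.1) : cquat R).
by rewrite mulrNN mulrN mulNr -opprD.
Qed.

Lemma cqconjD p q : cqconj (p + q) = cqconj p + cqconj q.
Proof. by rewrite /cqconj /= opprD. Qed.

Lemma cqconj0 : cqconj 0 = 0 :> cquat R.
Proof. by rewrite /cqconj /= oppr0. Qed.

Lemma cqconjZ (a : R) p : cqconj (a *: p) = a *: cqconj p.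
Proof. by rewrite /cqconj /= -scalerN. Qed.

Lemma cqconj1 : cqconj 1 = 1 :> cquat R.
Proof. by rewrite /cqconj /= oppr0. Qed.

Lemma cz_conjp z : cz (conjp z) = cqconj (cz z).
Proof. by rewrite /cz /cqconj /= scaleNr. Qed.

Lemma exp_sum_conj c z : geometric_growth c -> (forall n, cqconj (c n) = c n) ->
  exp_sum c (conjp z) = cqconj (exp_sum c z).
Proof.
move=> gc E; apply: exp_sum_eq.
have -> : series (exp_term c (conjp z)) = (fun n => cqconj (series (exp_term c z) n)).
  apply/funext => n; rewrite /series/= (big_morph _ cqconjD cqconj0); apply: eq_bigr => i _.
  have pc : cqconj (cz z ^+ i) = cqconj (cz z) ^+ i.
    by elim: i => [|i IH]; rewrite ?expr0 ?cqconj1// !exprS cqconjM IH.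
  by rewrite /exp_term cqconjZ cqconjM E cz_conjp pc.
have h := @cvg_exp_sum R c z gc.
exact: (cvg_pair (cvg_cquat1 h) (cvgN (cvg_cquat2 h))).
Qed.

Definition slice_eval (J : quat R) p : quat R := p.1 + J * p.2.

(** Evaluation [iota := J] is not multiplicative in general, but it respects a complex factor on the
    left, since [slice_point z J] commutes with [J]. *)
Lemma slice_eval_cz J z p : imag_units J ->
  slice_eval J (cz z * p) = slice_point z J * slice_eval J p.
Proof.
rewrite /imag_units /= expr2 => JJ.
rewrite -[cz z * p]/(z.1%:A * p.1 - z.2%:A * p.2, z.1%:A * p.2 + z.2%:A * p.1).
rewrite /slice_eval /slice_point /= mulrDl !mulrDr -!scalerAl !mul1r -!scalerAr.
by rewrite [J * (J * _)]mulrA JJ mulN1r scalerN [LHS]addrACA; congr (_ + _); exact: addrC.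
Qed.

Lemma slice_evalX J z (a : quat R) n : imag_units J ->
  slice_eval J (cz z ^+ n * (a, 0)) = slice_point z J ^+ n * a.
Proof.
move=> HJ; elim: n => [|n IH]; first by rewrite !expr0 !mul1r /slice_eval /= mulr0 addr0.
by rewrite !exprS -!mulrA slice_eval_cz// IH.
Qed.

Lemma cvg_slice_eval J c z (a : nat -> quat R) : geometric_growth c -> imag_units J ->
  (forall n, c n = (a n, 0)) ->
  series (fun n => (n`!%:R : R)^-1 *: (slice_point z J ^+ n * a n)) @ \oo -->
    slice_eval J (exp_sum c z).
Proof.
move=> gc HJ E.
have D p q : slice_eval J (p + q) = slice_eval J p + slice_eval J q.
  by rewrite /slice_eval /= mulrDr addrACA.
have Z0 : slice_eval J 0 = 0 by rewrite /slice_eval /= mulr0 addr0.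
have -> : series (fun n => (n`!%:R : R)^-1 *: (slice_point z J ^+ n * a n)) =
    (fun n => slice_eval J (series (exp_term c z) n)).
  apply/funext => n; rewrite /series/= (big_morph _ D Z0); apply: eq_bigr => i _.
  by rewrite /exp_term E -(slice_evalX _ _ _ HJ) /slice_eval /= scalerDr scalerAr.
have h := @cvg_exp_sum R c z gc.
apply: cvgD; first exact: cvg_cquat1.
by apply: cvg_quatM; [exact: cvg_cst|exact: cvg_cquat2].
Qed.

End EntireSeriesProperties.

(** * The coefficients of the generalized exponential *)

Section CompleteHomogeneous.
Variable R : realType.
Implicit Types (s : seq (quat R)) (m : quat R).

(* The list is read backwards: its head is the last factor of the products. *)
Fixpoint hom_rev s N : quat R :=
  if s is m :: s' then \sum_(j < N.+1) hom_rev s' (N - j)%N * m ^+ j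
  else (N == 0%N)%:R.

(** The product of the geometric series of the entries, truncated at degree [M]. The indeterminate
    is central, so the entries keep their order. *)
Definition geom_prod M s : {poly quat R} :=
  \prod_(i < size s) \poly_(k < M.+1) (s`_i ^+ k).

(** Distributivity expands the product into a sum over exponent functions without permuting factors,
    and taking the coefficient of degree [N] selects those of total [N]. *)
Lemma gexp_coef_geom_prod s N : gexp_coef s N = (geom_prod N s)`_N.
Proof.
rewrite /geom_prod; under [in RHS]eq_bigr do rewrite poly_def.
rewrite bigA_distr_bigA coef_sum /gexp_coef big_mkcond; apply: eq_bigr => f _.
have -> : \prod_(i < size s) (s`_i ^+ f i *: 'X^(f i)) =
    (\prod_(i < size s) s`_i ^+ f i) *: 'X^(\sum_i f i)%N :> {poly quat R}.
  elim/big_rec3: _ => [|i k a p _ ->]; first by rewrite expr0 scale1r.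
  rewrite -!mul_polyC polyCM exprD -!mulrA; congr (_ * _).
  by rewrite !mulrA; congr (_ * _); exact/esym/commr_polyXn.
by rewrite coefZ coefXn eq_sym; case: eqP => _; rewrite ?mulr1 ?mulr0.
Qed.

(** Splitting off the last factor calls for all lower degrees at the same truncation, hence [M]
    separate from [N]. *)
Lemma coef_geom_prod s M N : (N <= M)%N -> (geom_prod M s)`_N = hom_rev (rev s) N.
Proof.
elim/last_ind: s N => [|s m IH] N NM; first by rewrite /geom_prod big_ord0 coef1.
have E : \prod_(i < size s) \poly_(k < M.+1) ((rcons s m)`_i ^+ k) = geom_prod M s.
  by apply: eq_bigr => i _; rewrite nth_rcons ltn_ord.
rewrite rev_rcons /= /geom_prod size_rcons big_ord_recr /= E coefMr.
apply: eq_bigr => j _; rewrite nth_rcons ltnn eqxx coef_poly.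
by rewrite (leq_trans (ltn_ord j))// IH// (leq_trans _ NM)// leq_subr.
Qed.

Lemma gexp_coefE s N : gexp_coef s N = hom_rev (rev s) N.
Proof. by rewrite gexp_coef_geom_prod coef_geom_prod. Qed.

Lemma hom_rev0 s : hom_rev s 0 = 1.
Proof. by elim: s => [|m s IH] //=; rewrite big_ord1 IH expr0 mulr1. Qed.

Lemma hom_revS m s N : hom_rev (m :: s) N.+1 = hom_rev s N.+1 + hom_rev (m :: s) N * m.
Proof.
rewrite /= big_ord_recl subn0 expr0 mulr1 mulr_suml; congr (_ + _).
by apply: eq_bigr => i _; rewrite exprSr mulrA.
Qed.

(* The coefficient of x^n / n! in [gexp s]. *)
Definition gcoef s n : quat R :=
  if (size s <= n.+1)%N then gexp_coef s (n.+1 - size s) else 0.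

Lemma gcoef_nil n : gcoef [::] n = 0.
Proof. by rewrite /gcoef /= gexp_coefE. Qed.

(** Past the first nonzero index this is [hom_revS], before it everything is 0. At that index both
    sides are 1, which relies on the size test in [gcoef]: the truncated subtraction alone would
    produce a further 1. *)
Lemma gcoef_rcons s m n : gcoef (rcons s m) n.+1 = gcoef s n + gcoef (rcons s m) n * m.
Proof.
rewrite /gcoef size_rcons !ltnS subSS !gexp_coefE rev_rcons.
case: (ltngtP (size s) n.+1) => sn.
- by rewrite -ltnS sn subSS subSn ?hom_revS// -ltnS.
- by rewrite leqNgt ltnW//= mul0r addr0.
- by rewrite sn subnn !hom_rev0 ltnn mul0r addr0.
Qed.

Lemma gcoef1 m : gcoef [:: m] 0 = 1.
Proof. by rewrite /gcoef /= gexp_coefE hom_rev0. Qed.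

Definition ccoef s n : cquat R := (gcoef s n, 0).

Lemma ccoef_rcons s m n : ccoef (rcons s m) n.+1 = ccoef s n + ccoef (rcons s m) n * (m, 0).
Proof.
rewrite /ccoef gcoef_rcons.
rewrite -[RHS]/((gcoef s n + (gcoef (rcons s m) n * m - 0 * 0),
  0 + (gcoef (rcons s m) n * 0 + 0 * m)) : cquat R).
by rewrite !mul0r mulr0 subr0 !addr0.
Qed.

(** The new ratio is at least the ratio for [d] and at least [1 + 8 |q|], where 1 pays for [d n] and
    [8 |q|] for the product with [q]. *)
Lemma geometric_growth_rec (c d : nat -> cquat R) (q : cquat R) : geometric_growth d ->
  (forall n, c n.+1 = d n + c n * q) -> geometric_growth c.
Proof.
move=> [C [K [C0 K0 dCK]]] E; exists (C + `|c 0%N|), (K + 1 + 8 * `|q|).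
have q0 : 0 <= 8 * `|q| by rewrite mulr_ge0.
split=> [||n]; [by rewrite addr_ge0|by rewrite !addr_ge0|].
elim: n => [|n IH]; first by rewrite expr0 mulr1 lerDr.
set L := K + 1 + _ in IH *; set A := C + _ in IH *.
have KL : K ^+ n <= L ^+ n.
  by apply: lerXn2r; rewrite ?nnegrE /L//; lra.
have L0 : 0 <= L ^+ n by rewrite exprn_ge0// !addr_ge0.
have AL : 0 <= A * L ^+ n by rewrite mulr_ge0// addr_ge0.
rewrite E; apply: (le_trans (ler_normD _ _)).
apply: (@le_trans _ _ (A * L ^+ n * 1 + A * L ^+ n * (8 * `|q|))).
  apply: lerD; first by rewrite mulr1 (le_trans (dCK n))// ler_pM ?exprn_ge0// lerDl.
  by apply: (le_trans (cquat_normM _ _)); rewrite mulrCA ler_wpM2r.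
by rewrite -mulrDr exprSr mulrA ler_wpM2l// /L; lra.
Qed.

Lemma geometric_growth_ccoef s : geometric_growth (ccoef s).
Proof.
elim/last_ind: s => [|s m IH]; last exact: geometric_growth_rec IH (ccoef_rcons s m).
exists 0, 0; split=> // n; rewrite mul0r /ccoef gcoef_nil.
by rewrite -[(0, 0)]/(0 : cquat R) normr0.
Qed.

Lemma cvg_gexp s (x l : quat R) : s != [::] ->
  series (fun n => (n`!%:R : R)^-1 *: (x ^+ n * gcoef s n)) @ \oo --> l -> gexp s x = l.
Proof.
move=> s0 h; apply: cvg_lim => //; apply: cvg_trans h; apply: near_eq_cvg.
(* [gexp] starts summing at [size s - 1]; the sum is extended down to 0 by terms where [gcoef] is
   0. *)
near=> n; rewrite /series /= [RHS](big_nat_widenl _ 0)//.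
rewrite [RHS]big_mkcond /=; apply: eq_bigr => i _; rewrite /gcoef.
case: s s0 => //= m s _; rewrite ltnS; case: leqP => //= _.
  by rewrite scalerAl.
by rewrite mulr0 scaler0.
Unshelve. all: by end_near. Qed.

End CompleteHomogeneous.

(** * Holomorphic stem functions *)

Section HolomorphicStems.
Variable R : realType.
Implicit Types (D : set (R * R)) (F G : R * R -> cquat R) (z v : R * R) (p q : cquat R).

Lemma is_derive_cquatP F z v d : is_derive z v F d <->
  forall l, is_derive z v (fun y => (F y).1 ord0 l) (d.1 ord0 l) /\
            is_derive z v (fun y => (F y).2 ord0 l) (d.2 ord0 l).
Proof.
split=> [/is_deriveP/cvg_cquatP h l|h].
  have [h1 h2] := h l; split; apply/is_deriveP.
    by apply: cvg_trans h1; apply: near_eq_cvg; near=> t; rewrite /= !mxE.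
  by apply: cvg_trans h2; apply: near_eq_cvg; near=> t; rewrite /= !mxE.
apply/is_deriveP/cvg_cquatP => l; have [/is_deriveP h1 /is_deriveP h2] := h l; split.
  by apply: cvg_trans h1; apply: near_eq_cvg; near=> t; rewrite /= !mxE.
by apply: cvg_trans h2; apply: near_eq_cvg; near=> t; rewrite /= !mxE.
Unshelve. all: by end_near. Qed.

Lemma continuous_cquatP F z : {for z, continuous F} <->
  forall l, {for z, continuous (fun y => (F y).1 ord0 l)} /\
            {for z, continuous (fun y => (F y).2 ord0 l)}.
Proof. by split=> [/cvg_cquatP|h]; [|apply/cvg_cquatP]. Qed.

Lemma is_derive_coord F z v d l : is_derive z v F d ->
  is_derive z v (fun y => (F y).1 ord0 l) (d.1 ord0 l) /\
  is_derive z v (fun y => (F y).2 ord0 l) (d.2 ord0 l).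
Proof. by move/is_derive_cquatP. Qed.

Lemma continuous_coord F z l : {for z, continuous F} ->
  {for z, continuous (fun y => (F y).1 ord0 l)} /\
  {for z, continuous (fun y => (F y).2 ord0 l)}.
Proof. by move/continuous_cquatP. Qed.

Lemma is_derive_cquatM F G z v dF dG : {for z, continuous G} ->
  is_derive z v F dF -> is_derive z v G dG ->
  is_derive z v (fun y => F y * G y) (dF * G z + F z * dG).
Proof.
move=> cG /is_deriveP hF /is_deriveP hG; apply/is_deriveP.
have sh : (fun h : R => h *: v + z) h @[h --> 0^'] --> z.
  rewrite -[X in _ --> X]add0r; apply: cvgD; last exact: cvg_cst.
  rewrite -[X in _ --> X](scale0r v).
  by apply: cvgZr_tmp; apply: cvg_within; exact: cvg_id.
have cGh : G (h *: v + z) @[h --> 0^'] --> G z by apply: (cvg_comp _ _ sh cG).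
have hFG : (h^-1 *: (F (h *: v + z) - F z) : cquat R) * G (h *: v + z) @[h --> 0^'] -->
    dF * G z by exact: cvg_cquatM.
have hGF : F z * (h^-1 *: (G (h *: v + z) - G z)) @[h --> 0^'] --> F z * dG.
  by apply: cvg_cquatM; [exact: cvg_cst|exact: hG].
apply: cvg_trans (cvgD hFG hGF); apply: near_eq_cvg; near=> h.
rewrite -[LHS]/((h^-1 *: (F (h *: v + z) - F z) : cquat R) * G (h *: v + z)
  + F z * (h^-1 *: (G (h *: v + z) - G z))).
rewrite -cqscalerAl -cqscalerAr -scalerDr; congr (_ *: _).
by rewrite mulrBl mulrBr addrA subrK.
Unshelve. all: by end_near. Qed.

(** The Cauchy-Riemann equations with the derivative named. Continuity of [F] is recorded for use in
    the product rule. *)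
Definition holo D F F' := forall z, D z ->
  [/\ is_derive z ((1, 0) : R * R) F (F' z),
      is_derive z ((0, 1) : R * R) F (iota_unit * F' z),
      {for z, continuous F} & {for z, continuous F'}].

Lemma iotaM p : iota_unit * p = (- p.2, p.1).
Proof.
rewrite -[LHS]/((0 * p.1 - 1 * p.2, 0 * p.2 + 1 * p.1) : cquat R).
by rewrite !mul0r !mul1r sub0r add0r.
Qed.

Lemma iota_iotaM p : iota_unit * (iota_unit * p) = - p.
Proof. by rewrite !iotaM. Qed.

Lemma iotaC p q : p * (iota_unit * q) = iota_unit * (p * q).
Proof. by rewrite -cz_iota mulrA -czC mulrA. Qed.

Lemma near_continuous (T U : topologicalType) (f g : T -> U) x :
  (\forall y \near x, f y = g y) -> {for x, continuous f} -> {for x, continuous g}.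
Proof.
move=> fg cf; have : f y @[y --> x] --> g x by rewrite -(nbhs_singleton fg).
by apply: cvg_trans; apply: near_eq_cvg.
Qed.

Lemma near_open D (P : R * R -> Prop) z : open D -> D z ->
  (forall y, D y -> P y) -> \forall y \near z, P y.
Proof. by move=> oD Dz DP; apply: filterS (open_nbhs_nbhs (conj oD Dz)). Qed.

Lemma holo_ext D F G F' G' : open D -> (forall z, D z -> F z = G z) ->
  (forall z, D z -> F' z = G' z) -> holo D F F' -> holo D G G'.
Proof.
move=> oD FG FG' h z Dz; have [h1 h2 h3 h4] := h z Dz; rewrite -FG'; last exact: Dz.
have nF := near_open oD Dz FG; have nF' := near_open oD Dz FG'.
split; [exact: near_eq_is_derive h1|exact: near_eq_is_derive h2| |].
  exact: near_continuous h3.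
exact: near_continuous h4.
Qed.

Lemma d_alpha_holo D F F' z : holo D F F' -> D z -> d_alpha F z = F' z.
Proof. by move=> h Dz; have [h1 _ _ _] := h z Dz; rewrite /d_alpha derive_val. Qed.

Lemma d_beta_holo D F F' z : holo D F F' -> D z -> d_beta F z = iota_unit * F' z.
Proof. by move=> h Dz; have [_ h1 _ _] := h z Dz; rewrite /d_beta derive_val. Qed.

Lemma d_z_holo D F F' z : holo D F F' -> D z -> d_z F z = F' z.
Proof.
move=> h Dz; rewrite /d_z (d_alpha_holo h Dz) (d_beta_holo h Dz) iota_iotaM opprK.
by rewrite -mulr2n -[X in _ *: X]scaler_nat scalerA mulVf ?scale1r// pnatr_eq0.
Qed.

Lemma d_zbar_holo D F F' z : holo D F F' -> D z -> d_zbar F z = 0.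
Proof.
move=> h Dz; rewrite /d_zbar (d_alpha_holo h Dz) (d_beta_holo h Dz) iota_iotaM.
by rewrite subrr scaler0.
Qed.

Lemma stem_C1_holo D F F' : open D -> holo D F F' -> stem_C1 D F.
Proof.
move=> oD h z Dz; have [h1 h2 h3 h4] := h z Dz; split; [by case: h1|by case: h2| |].
  apply: near_continuous h4; apply: (near_open oD Dz) => y Dy.
  by rewrite (d_alpha_holo h Dy).
apply: (@near_continuous _ _ (fun y => iota_unit * F' y)).
  by apply: (near_open oD Dz) => y Dy; rewrite (d_beta_holo h Dy).
by apply: cvg_cquatM; [exact: cvg_cst|exact: h4].
Qed.

Lemma holo_stem_C1 D F : open D -> stem_C1 D F -> (forall z, D z -> d_zbar F z = 0) ->
  holo D F (d_alpha F).
Proof.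
move=> oD h hbar z Dz; have [h1 h2 h3 h4] := h z Dz.
(* The equation [d_zbar F z = 0] multiplied by [iota]. *)
have E : d_beta F z = iota_unit * d_alpha F z.
  have := hbar z Dz; rewrite /d_zbar => /eqP; rewrite scaler_eq0 invr_eq0 pnatr_eq0 /=.
  by rewrite addr_eq0 => /eqP ->; rewrite mulrN iota_iotaM opprK.
have d1 : is_derive z ((1, 0) : R * R) F (d_alpha F z) := derivableP h1.
have d2 := is_derive_eq (derivableP h2) E.
split; [exact d1|exact d2| |exact h3].
apply/continuous_cquatP => l.
pose a1 y := (d_alpha F y).1 ord0 l; pose a2 y := (d_alpha F y).2 ord0 l.
pose b1 y := (d_beta F y).1 ord0 l; pose b2 y := (d_beta F y).2 ord0 l.
suff [p1 p2] : partials_on D (fun y => (F y).1 ord0 l) a1 b1 /\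
    partials_on D (fun y => (F y).2 ord0 l) a2 b2.
  by split; [exact: (partials_continuous oD p1)|exact: (partials_continuous oD p2)].
suff k y : D y -> [/\ is_derive y ((1, 0) : R * R) F (d_alpha F y),
    is_derive y ((0, 1) : R * R) F (d_beta F y),
    {for y, continuous (d_alpha F)} & {for y, continuous (d_beta F)}].
  split=> y /k[k1 k2 k3 k4].
    exact: And4 (is_derive_coord l k1).1 (is_derive_coord l k2).1
      (continuous_coord l k3).1 (continuous_coord l k4).1.
  exact: And4 (is_derive_coord l k1).2 (is_derive_coord l k2).2
    (continuous_coord l k3).2 (continuous_coord l k4).2.
move=> /h[k1 k2 k3 k4].
exact: And4 (derivableP k1) (derivableP k2) k3 k4.
Qed.

(** For each of the four quaternionic coordinates, the pair of coordinates of [F.1] and [F.2] is a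
    complex holomorphic function, to which [holo2_deriv] applies on a ball. The local derivatives
    agree with [d_alpha F'], which does not depend on the ball. *)
Lemma holo_deriv D F F' : open D -> holo D F F' -> holo D F' (d_alpha F').
Proof.
move=> oD h z0 Dz0.
have [e /= e0 ze] := (nbhs_ballP _ _).1 (open_nbhs_nbhs (conj oD Dz0)).
pose r := e / 2; have r0 : 0 < r by rewrite divr_gt0.
have rD : ball z0 (2 * r) `<=` D by rewrite /r mulrC divfK.
have hl l : exists P : R * R -> R * R, holo2 (ball z0 r) (fun y => (F' y).1 ord0 l)
    (fun y => (F' y).2 ord0 l) (fun y => (P y).1) (fun y => (P y).2).
  have [|p' [q' H]] := @holo2_deriv _ D (fun y => (F y).1 ord0 l) (fun y => (F y).2 ord0 l)
    (fun y => (F' y).1 ord0 l) (fun y => (F' y).2 ord0 l) z0 r oD _ r0 rD.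
    split=> y /h[/(is_derive_coord l)[k1 k1'] /(is_derive_coord l)[k2 k2']
      _ /(continuous_coord l)[k3 k3']]; rewrite iotaM /= ?mxE in k2 k2'.
      exact: And4 k1 k2 k3 (cvgN k3').
    exact: And4 k1' k2' k3' k3.
  by exists (fun y => (p' y, q' y)).
have [P HP] := choice hl.
pose G y : cquat R := (\row_l (P l y).1, \row_l (P l y).2).
have oB : open (ball z0 r) by exact: ball_open.
have Bz0 : ball z0 r z0 by exact: ballxx.
have cF' y : D y -> {for y, continuous F'} by move=> /h[].
have hG : holo (ball z0 r) F' G.
  move=> y By; have Dy : D y by apply: rD; apply: le_ball By; lra.
  split; [| |exact: cF'|].
  - apply/is_derive_cquatP => l; have [H1 H2] := HP l.
    by rewrite !mxE; have [? _ _ _] := H1 y By; have [? _ _ _] := H2 y By.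
  - apply/is_derive_cquatP => l; have [H1 H2] := HP l.
    by rewrite iotaM !mxE; have [_ ? _ _] := H1 y By; have [_ ? _ _] := H2 y By.
  - apply/continuous_cquatP => l; have [H1 H2] := HP l; split.
      have [_ _ k _] := H1 y By; apply: near_continuous k.
      by near=> t; rewrite mxE.
    have [_ _ k _] := H2 y By; apply: near_continuous k.
    by near=> t; rewrite mxE.
have dG y : ball z0 r y -> G y = d_alpha F' y.
  by move=> By; rewrite (d_alpha_holo hG By).
exact: (holo_ext oB (fun _ _ => erefl) dG hG).
Unshelve. all: by end_near. Qed.

End HolomorphicStems.

(** * The equation on stem functions *)

Section StemEquation.
Variable R : realType.
Implicit Types (D : set (R * R)) (F G : R * R -> cquat R) (z v : R * R) (p q : cquat R)
  (m : quat R) (s : seq (quat R)).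

Lemma holoM D F G F' G' : holo D F F' -> holo D G G' ->
  holo D (fun z => F z * G z) (fun z => F' z * G z + F z * G' z).
Proof.
move=> hF hG z Dz; have [F1 F2 F3 F4] := hF z Dz; have [G1 G2 G3 G4] := hG z Dz.
split; first exact: is_derive_cquatM.
- apply: (is_derive_eq (is_derive_cquatM G3 F2 G2)).
  by rewrite iotaC -mulrA -mulrDr.
- exact: cvg_cquatM.
- by apply: cvgD; exact: cvg_cquatM.
Qed.

Lemma holo_cst D p : holo D (fun=> p) (fun=> 0).
Proof.
move=> z _; split.
- exact: is_derive_cst.
- by rewrite mulr0; exact: is_derive_cst.
- exact: cvg_cst.
- exact: cvg_cst.
Qed.

Lemma holoB D F G F' G' : holo D F F' -> holo D G G' ->
  holo D (fun z => F z - G z) (fun z => F' z - G' z).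
Proof.
move=> hF hG z Dz; have [F1 F2 F3 F4] := hF z Dz; have [G1 G2 G3 G4] := hG z Dz.
split; [exact: is_deriveB|by rewrite mulrBr; exact: is_deriveB|exact: cvgB|exact: cvgB].
Qed.

Lemma holoD D F G F' G' : holo D F F' -> holo D G G' ->
  holo D (fun z => F z + G z) (fun z => F' z + G' z).
Proof.
move=> hF hG z Dz; have [F1 F2 F3 F4] := hF z Dz; have [G1 G2 G3 G4] := hG z Dz.
split; [exact: is_deriveD|by rewrite mulrDr; exact: is_deriveD|exact: cvgD|exact: cvgD].
Qed.

Lemma holo_sum D n (F F' : nat -> R * R -> cquat R) :
  (forall i, (i < n)%N -> holo D (F i) (F' i)) ->
  holo D (fun z => \sum_(i < n) F i z) (fun z => \sum_(i < n) F' i z).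
Proof.
elim: n => [|n IH] h.
  rewrite (_ : (fun z => _) = fun=> 0); last by apply/funext => z; rewrite big_ord0.
  rewrite (_ : (fun z => \sum_(i < 0) F' i z) = fun=> 0); first exact: holo_cst.
  by apply/funext => z; rewrite big_ord0.
have hn : holo D (F n) (F' n) by exact: h.
have := holoD (IH (fun i ni => h i (ltnW ni))) hn.
by congr holo; apply/funext => z; rewrite big_ord_recr.
Qed.

(** Differentiate the symmetry of [F] along the real direction, which conjugation of the plane
    leaves unchanged. *)
Lemma holo_comp_conj D F F' : (forall z, D z -> D (conjp z)) -> open D ->
  stem D F -> holo D F F' -> stem D F'.
Proof.
move=> cD oD sF h z Dz.
have [h1 _ _ _] := h _ Dz; have [k1 _ _ _] := h _ (cD _ Dz).
have e1 : is_derive z ((1, 0) : R * R) (fun y => F (conjp y)) (F' (conjp z)).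
  apply/is_deriveP; move/is_deriveP : k1; apply: cvg_trans; apply: near_eq_cvg.
  near=> t; congr (_ *: (F _ - F _)).
  by rewrite -[LHS]/(t * 1 + z.1, t * 0 - z.2) -[RHS]/(t * 1 + z.1, - (t * 0 + z.2)) mulr0 !add0r.
have e2 : is_derive z ((1, 0) : R * R) (fun y => cqconj (F y)) (cqconj (F' z)).
  apply/is_derive_cquatP => l; have [a b] := is_derive_coord l h1.
  split; first exact: a.
  rewrite /cqconj /= mxE; have := is_deriveN b; apply: near_eq_is_derive.
  by near=> t; rewrite /= mxE.
have E : 'D_((1, 0) : R * R) (fun y => F (conjp y)) z =
    'D_((1, 0) : R * R) (fun y => cqconj (F y)) z.
  by apply: near_eq_derive; exact: near_open oD Dz sF.
by rewrite -(@derive_val _ _ _ _ _ _ _ e1) E (@derive_val _ _ _ _ _ _ _ e2).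
Unshelve. all: by end_near. Qed.

Definition gstem s : R * R -> cquat R := exp_sum (ccoef s).

Lemma gstem_nil z : gstem [::] z = 0.
Proof.
apply: exp_sum_eq.
rewrite (_ : series _ = fun=> 0); first exact: cvg_cst.
apply/funext => n; rewrite /series/= big1// => i _.
by rewrite /exp_term /ccoef gcoef_nil -[(0, 0)]/(0 : cquat R) mulr0 scaler0.
Qed.

Lemma stem_gstem D s : stem D (gstem s).
Proof.
move=> z _; apply: exp_sum_conj; first exact: geometric_growth_ccoef.
by move=> n; rewrite /cqconj /= oppr0.
Qed.

Lemma holo_exp_sum D c : geometric_growth c ->
  holo D (exp_sum c) (exp_sum (shift_seq c)).
Proof.
move=> g z _; have c1 := @continuous_exp_sum _ _ z g.
have c2 := @continuous_exp_sum _ _ z (geometric_growth_shift g).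
have := is_derive_exp_sum z (0, 1) g; have := is_derive_exp_sum z (1, 0) g.
by rewrite cz1 cz_iota mul1r => d1 d2; exact: And4 d1 d2 c1 c2.
Qed.

Lemma holo_gstem D s m :
  holo D (gstem (rcons s m)) (fun z => gstem s z + gstem (rcons s m) z * (m, 0)).
Proof.
have -> : (fun z => gstem s z + gstem (rcons s m) z * (m, 0)) =
    exp_sum (shift_seq (ccoef (rcons s m))).
  apply/funext => z; apply/esym/exp_sum_shift_rec => [||n].
  - exact: geometric_growth_ccoef.
  - exact: geometric_growth_ccoef.
  - exact: ccoef_rcons.
exact/holo_exp_sum/geometric_growth_ccoef.
Qed.

Lemma cquat_embM m m' : ((m, 0) : cquat R) * (m', 0) = (m * m', 0).
Proof.
rewrite -[LHS]/((m * m' - 0 * 0, m * 0 + 0 * m') : cquat R).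
by rewrite !mul0r mulr0 subr0 addr0.
Qed.

(** The coefficients of [E_m] are the powers of [m]. *)
Lemma gstem1_comm m z : gstem [:: m] z * (m, 0) = ((m, 0) : cquat R) * gstem [:: m] z.
Proof.
apply: exp_sum_comm; first exact: geometric_growth_ccoef.
have gS n : gcoef [:: m] n.+1 = gcoef [:: m] n * m.
  by rewrite -[[:: m]]/(rcons [::] m) gcoef_rcons gcoef_nil add0r.
move=> n; rewrite /ccoef !cquat_embM; congr (_, _).
by elim: n => [|n IH]; rewrite ?gcoef1 ?mul1r ?mulr1// gS [in LHS]IH -mulrA.
Qed.

Lemma is_derive0_cst (f : R -> R) : (forall t : R, is_derive t (1 : R) f 0) -> forall t, f t = f 0.
Proof.
move=> df t; have [y [_ _]] := @MVT_abs R f (fun=> 0) 0 t (fun y _ _ => df y).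
by rewrite add0r mul0r => /eqP; rewrite subr_eq0 => /eqP.
Qed.

Lemma holo0_cst F : holo setT F (fun=> 0) -> forall z, F z = F 0.
Proof.
move=> h [a b].
have coord l (y : R * R) : [/\ is_derive y ((1, 0) : R * R) (fun y => (F y).1 ord0 l) 0,
    is_derive y ((0, 1) : R * R) (fun y => (F y).1 ord0 l) 0,
    is_derive y ((1, 0) : R * R) (fun y => (F y).2 ord0 l) 0 &
    is_derive y ((0, 1) : R * R) (fun y => (F y).2 ord0 l) 0].
  have [k1 k2 _ _] := h y I; rewrite mulr0 in k2.
  have [a1 a2] := is_derive_coord l k1; have [b1 b2] := is_derive_coord l k2.
  by rewrite !mxE in a1 a2 b1 b2; exact: And4 a1 b1 a2 b2.
have path (f : R * R -> R) : (forall y, is_derive y ((1, 0) : R * R) f 0) ->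
    (forall y, is_derive y ((0, 1) : R * R) f 0) -> f (a, b) = f 0.
  move=> f1 f2.
  have := is_derive0_cst (fun t => is_derive_line (f2 ((a, 0) + t *: ((0, 1) : R * R)))) b.
  have := is_derive0_cst (fun t => is_derive_line (f1 ((0, 0) + t *: ((1, 0) : R * R)))) a.
  by rewrite !plane_shift1 !plane_shift2 !add0r => -> ->.
have E1 l : (F (a, b)).1 ord0 l = (F 0).1 ord0 l.
  by apply: (path (fun y => (F y).1 ord0 l)) => y; case: (coord l y).
have E2 l : (F (a, b)).2 ord0 l = (F 0).2 ord0 l.
  by apply: (path (fun y => (F y).2 ord0 l)) => y; case: (coord l y).
by case: (F (a, b)) (F 0) E1 E2 => [x y] [x' y'] /= E1 E2; congr (_, _); apply/rowP.
Qed.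

Lemma holo_gstem1 D m :
  holo D (gstem [:: m]) (fun z => gstem [:: m] z * (m, 0)).
Proof.
have := @holo_gstem D [::] m; congr holo.
by apply/funext => z; rewrite gstem_nil add0r.
Qed.

(** Since [E_m] commutes with [m], the derivative of the product is [E_(-m) (- m + m) E_m = 0]. The
    product is thus constant on the plane, and its value at 0 is 1. *)
Lemma gstem1_inv m z : gstem [:: - m] z * gstem [:: m] z = 1.
Proof.
have h0 : holo setT (fun z => gstem [:: - m] z * gstem [:: m] z) (fun=> 0).
  apply: (holo_ext openT (fun _ _ => erefl) _
    (holoM (@holo_gstem1 setT (- m)) (@holo_gstem1 setT m))) => y _.
  rewrite (gstem1_comm m) mulrA -mulrDl -mulrDr.
  by rewrite -[X in _ * X * _]/((- m + m, 0 + 0) : cquat R) addNr addr0 mulr0 mul0r.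
rewrite (holo0_cst h0) /gstem !exp_sum0; try exact: geometric_growth_ccoef.
by rewrite /ccoef !gcoef1 mulr1.
Qed.

Definition stem_op m F z : cquat R := d_z F z - F z * (m, 0).

Definition stem_ops s F : R * R -> cquat R := foldr stem_op F s.

Lemma stem_op_holo D m F F' z : holo D F F' -> D z -> stem_op m F z = F' z - F z * (m, 0).
Proof. by move=> h Dz; rewrite /stem_op (d_z_holo h Dz). Qed.

Lemma holo_stem_op D m F F' : open D -> holo D F F' -> exists F'', holo D (stem_op m F) F''.
Proof.
move=> oD h; have h' := holo_deriv oD h; eexists.
apply: (holo_ext oD _ (fun _ _ => erefl) (holoB h' (holoM h (holo_cst (m, 0))))) => z Dz.
by rewrite (stem_op_holo _ h Dz).
Qed.

Lemma stemM D F G : stem D F -> stem D G -> stem D (fun z => F z * G z).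
Proof. by move=> sF sG z Dz; rewrite sF// sG// cqconjM. Qed.

Lemma stem_stem_op D m F F' : (forall z, D z -> D (conjp z)) -> open D -> holo D F F' ->
  stem D F -> stem D (stem_op m F).
Proof.
move=> cD oD h sF z Dz; have sF' := holo_comp_conj cD oD sF h.
rewrite (stem_op_holo _ h (cD z Dz)) (stem_op_holo _ h Dz) sF'// sF//.
have eN p : cqconj (- p) = - cqconj p by rewrite /cqconj.
have cm : cqconj ((m, 0) : cquat R) = (m, 0) by rewrite /cqconj /= oppr0.
by rewrite cqconjD eN cqconjM cm.
Qed.

Lemma stem_op_eq D m F G z : open D -> (forall z, D z -> F z = G z) -> D z ->
  stem_op m F z = stem_op m G z.
Proof.
move=> oD FG Dz; have n := near_open oD Dz FG.
by rewrite /stem_op /d_z /d_alpha /d_beta !(near_eq_derive _ n) FG.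
Qed.

(** The operators are local on the open set [D], so equations known only on [D] may be used inside
    them. *)
Lemma stem_ops_eq D s F G z : open D -> (forall z, D z -> F z = G z) -> D z ->
  stem_ops s F z = stem_ops s G z.
Proof.
by move=> oD FG; elim: s z => [|m s IH] z Dz /=; [exact: FG|exact: stem_op_eq oD IH Dz].
Qed.

Lemma stem_ops_gstem D s z : open D -> D z -> stem_ops s (gstem s) z = 0.
Proof.
move=> oD; elim/last_ind: s z => [|s m IH] z Dz; first exact: gstem_nil.
rewrite /stem_ops foldr_rcons -/(stem_ops s _) -[RHS](IH z Dz).
apply: (stem_ops_eq _ oD) => // y Dy.
by rewrite (stem_op_holo _ (@holo_gstem D s m) Dy) addrK.
Qed.

Lemma stem_solution D s F F' : (forall z, D z -> D (conjp z)) -> open D ->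
  holo D F F' -> stem D F -> (forall z, D z -> stem_ops s F z = 0) ->
  exists H : nat -> R * R -> cquat R,
    (forall i, (i < size s)%N -> stem D (H i) /\ holo D (H i) (fun=> 0)) /\
    forall z, D z -> F z = \sum_(i < size s) H i z * gstem (drop i s) z.
Proof.
move=> cD oD; elim/last_ind: s F F' => [|s m IH] F F' hF sF eF.
  by exists (fun _ => fun=> 0); split=> // z Dz; rewrite big_ord0; exact: eF.
(* The operator of the last entry acts first; its image solves the equation for [s], and is
   holomorphic thanks to [holo_deriv]. *)
have [F1 hF1] := holo_stem_op m oD hF.
have [|H [HH HE]] := IH _ _ hF1 (stem_stem_op m cD oD hF sF).
  by move=> z Dz; have := eF z Dz; rewrite /stem_ops foldr_rcons.
pose g i := gstem (rcons (drop i s) m).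
pose U z := F z - \sum_(i < size s) H i z * g i z.
(* The sum subtracted in [U] has the same image as [F] under the operator of [m], because each [g i]
   is sent to [gstem (drop i s)] and the left factors [H i] have derivative 0. *)
have hU : holo D U (fun z => U z * (m, 0)).
  have hS := holo_sum (F := fun i z => H i z * g i z)
    (F' := fun i z => 0 * g i z + H i z * (gstem (drop i s) z + g i z * (m, 0)))
    (fun i si => holoM (HH i si).2 (@holo_gstem D (drop i s) m)).
  apply: (holo_ext oD (fun _ _ => erefl) _ (holoB hF hS)) => z Dz.
  have := stem_op_holo m hF Dz; rewrite (HE z Dz) => E.
  have -> : \sum_(i < size s) (0 * g i z + H i z * (gstem (drop i s) z + g i z * (m, 0))) =
      (F' z - F z * (m, 0)) + (\sum_(i < size s) H i z * g i z) * (m, 0).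
    rewrite -E mulr_suml -big_split; apply: eq_bigr => i _ /=.
    by rewrite mul0r add0r mulrDr mulrA.
  by rewrite opprD opprB addrA [F' z + _]addrC subrK -mulrBl.
have sU : stem D U.
  move=> z Dz; rewrite /U (sF z Dz) [RHS]cqconjD; congr (_ + _).
  have eN p : cqconj (- p) = - cqconj p by rewrite /cqconj.
  rewrite eN (big_morph _ (@cqconjD R) (@cqconj0 R)); congr (- _).
  apply: eq_bigr => i _; have [sH _] := HH i (ltn_ord i).
  by rewrite (sH z Dz) /g (@stem_gstem D _ z Dz) cqconjM.
(* Variation of constants: this is the coefficient of the new term [E_m], recovered from [U] by
   [gstem1_inv]. *)
pose Hl z := U z * gstem [:: - m] z.
have hHl : holo D Hl (fun=> 0).
  apply: (holo_ext oD (fun _ _ => erefl) _ (holoM hU (@holo_gstem1 D (- m)))) => z Dz.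
  rewrite (gstem1_comm (- m)) mulrA -mulrDl -mulrDr.
  by rewrite -[X in _ * X * _]/((m - m, 0 + 0) : cquat R) subrr addr0 mulr0 mul0r.
exists (fun i => if (i < size s)%N then H i else Hl); split.
  move=> i _; case: ifP => [/HH//|_]; split; last exact: hHl.
  exact: stemM sU (@stem_gstem D _).
move=> z Dz; rewrite size_rcons big_ord_recr /= ltnn drop_rcons// drop_size.
rewrite [Hl z]/(U z * _) -mulrA gstem1_inv mulr1 /U addrC.
rewrite -[LHS](subrK (\sum_(i < size s) H i z * g i z)); congr (_ + _).
apply: eq_bigr => i _; rewrite ltn_ord drop_rcons ?[(i <= _)%N]ltnW ?ltn_ord//.
Qed.

End StemEquation.

(** * From stem functions to slice functions *)

Section SliceTransfer.
Variable R : realType.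
Implicit Types (D : set (R * R)) (F G : R * R -> cquat R) (f g : quat R -> quat R).

Lemma stem_of_spec D F f : stem D F -> induces D F f ->
  stem D (stem_of D f) /\ induces D (stem_of D f) f.
Proof. by move=> sF iF; rewrite /stem_of; case: xgetP => [K _ //|/(_ F)]; case. Qed.

Lemma stem_of_eq D F f : stem D F -> induces D F f -> forall z, D z -> stem_of D f z = F z.
Proof. by move=> sF iF; have [_ iK] := stem_of_spec sF iF; exact: induces_inj iK iF. Qed.

Lemma stem_ext D F G : (forall z, D z -> D (conjp z)) -> (forall z, D z -> F z = G z) ->
  stem D F -> stem D G.
Proof. by move=> cD FG sF z Dz; rewrite -FG ?sF ?FG//; exact: cD. Qed.

Lemma induces_ext D F G f : (forall z, D z -> F z = G z) -> induces D F f -> induces D G f.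
Proof. by move=> FG iF z J Dz HJ; rewrite (iF z J Dz HJ) FG. Qed.

Lemma d_z_stem_of D F F' f : open D -> stem D F -> induces D F f -> holo D F F' ->
  forall z, D z -> d_z (stem_of D f) z = F' z.
Proof.
move=> oD sF iF hF z Dz.
have e y : D y -> F y = stem_of D f y by move=> Dy; rewrite (stem_of_eq sF iF).
by rewrite (d_z_holo (holo_ext oD e (fun _ _ => erefl) hF) Dz).
Qed.

(** The chosen stem function agrees with [F] on the open set [D], hence so do the derivatives there;
    outside [D] the choice has no effect. *)
Lemma induces_slice_derivative D F F' f : (forall z, D z -> D (conjp z)) -> open D ->
  stem D F -> induces D F f -> holo D F F' -> induces D F' (slice_derivative D f).
Proof.
move=> cD oD sF iF hF; have e := d_z_stem_of oD sF iF hF.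
apply: (induces_ext e); apply: slice_fun_induces.
by apply: (stem_ext cD _ (holo_comp_conj cD oD sF hF)) => z Dz; rewrite e.
Qed.

(** Pointwise right multiplication by [m] is right multiplication of the stem by [(m, 0)], as [m]
    stays to the right of [J]. *)
Lemma induces_slice_op D F F' f m : (forall z, D z -> D (conjp z)) -> open D ->
  stem D F -> induces D F f -> holo D F F' -> induces D (stem_op m F) (slice_op D m f).
Proof.
move=> cD oD sF iF hF z J Dz HJ; rewrite (stem_op_holo m hF Dz) /slice_op.
rewrite (induces_slice_derivative cD oD sF iF hF Dz HJ) (iF z J Dz HJ).
rewrite -[F z * (m, 0)]/((F z).1 * m - (F z).2 * 0, (F z).1 * 0 + (F z).2 * m).
by rewrite /= !mulr0 subr0 add0r mulrDl mulrBr opprD addrACA mulrA.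
Qed.

Lemma induces_slice_ops D F F' f s : (forall z, D z -> D (conjp z)) -> open D ->
  stem D F -> induces D F f -> holo D F F' ->
  [/\ induces D (stem_ops s F) (slice_ops D s f), stem D (stem_ops s F) &
      exists G', holo D (stem_ops s F) G'].
Proof.
move=> cD oD sF iF hF; elim: s => [|m s [IH1 IH2 [G' IH3]]] /=; first by split=> //; exists F'.
split; [exact: induces_slice_op IH3|exact: stem_stem_op IH3 IH2|exact: holo_stem_op IH3].
Qed.

Lemma circularization_eq0 D F f : induces D F f ->
  (forall x, circularization D x -> f x = 0) <-> (forall z, D z -> F z = 0).
Proof.
move=> iF; split=> [f0|F0 x [z Dz [J HJ ->]]].
  apply: (induces_inj iF) => z J Dz HJ; rewrite mulr0 addr0 f0//.
  by exists z => //; exists J.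
by rewrite (iF z J Dz HJ) F0// mulr0 addr0.
Qed.

Lemma induces_gexp D (s : seq (quat R)) : s != [::] -> induces D (gstem s) (gexp s).
Proof.
move=> s0 z J Dz HJ; apply: cvg_gexp => //.
exact: (cvg_slice_eval (@geometric_growth_ccoef R s) HJ (fun=> erefl)).
Qed.

Lemma slice_regular_holo D F F' f : open D -> stem D F -> induces D F f ->
  holo D F F' -> slice_regular D f.
Proof.
move=> oD sF iF hF; exists F; split; [exact: sF|exact: iF|exact: stem_C1_holo hF|].
by move=> z Dz; exact: d_zbar_holo hF Dz.
Qed.

End SliceTransfer.

Theorem corollary15 (R : realType) (D : set (R * R)) (m : nat)
    (lambda : m.-tuple (quat R)) :
  axially_symmetric_domain D -> (1 <= m)%N ->
  (slice_regular D (gexp lambda) /\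
   forall x, circularization D x -> slice_ops D lambda (gexp lambda) x = 0) /\
  (forall f : quat R -> quat R, slice_regular D f ->
   (forall x, circularization D x -> slice_ops D lambda f x = 0) ->
   exists h : 'I_m -> quat R -> quat R,
     (forall i, slice_constant D (h i)) /\
     forall x, circularization D x ->
       f x = \sum_(i < m) slice_mul D (h i) (gexp (drop i lambda)) x).
Proof.
move=> [oD cD _] m1.
have hG s : holo D (gstem s) (exp_sum (shift_seq (ccoef s))).
  exact/holo_exp_sum/geometric_growth_ccoef.
have dropN i : (i < m)%N -> drop i lambda != [::].
  by move=> im; rewrite -size_eq0 size_drop size_tuple subn_eq0 -ltnNge.
have iG := @induces_gexp _ D _ (dropN 0%N m1); rewrite drop0 in iG.
split.
  split; first exact: slice_regular_holo oD (@stem_gstem _ D _) iG (hG _).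
  have [iS _ _] := induces_slice_ops lambda cD oD (@stem_gstem _ D lambda) iG (hG _).
  by apply/(circularization_eq0 iS) => z Dz; exact: stem_ops_gstem oD Dz.
move=> f [F [sF iF /(holo_stem_C1 oD) C1F /C1F hF]] f0.
have [iS _ _] := induces_slice_ops lambda cD oD sF iF hF.
have [H [HH HE]] := stem_solution cD oD hF sF ((circularization_eq0 iS).1 f0).
rewrite size_tuple in HH HE.
have iH i : (i < m)%N -> induces D (H i) (slice_fun (H i)).
  by move=> /HH[sH _]; exact: slice_fun_induces.
exists (fun i => slice_fun (H i)); split=> [i|x [z Dz [J HJ ->]]].
  have [sH hH] := HH i (ltn_ord i); split.
    exact: slice_regular_holo oD sH (iH i (ltn_ord i)) hH.
  have iD := induces_slice_derivative cD oD sH (iH i (ltn_ord i)) hH.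
  exact: (circularization_eq0 iD).2.
rewrite (iF z J Dz HJ) (HE z Dz) -/(slice_eval J _).
(* Evaluation at [J] is additive, so it passes through the sum; the products stay at the level of
   stem functions, where [slice_mul] is defined. *)
have D2 : {morph @slice_eval R J : p q / p + q}.
  by move=> p q; rewrite /slice_eval /= mulrDr addrACA.
have Z2 : slice_eval J 0 = 0 by rewrite /slice_eval /= mulr0 addr0.
rewrite (big_morph _ D2 Z2); apply: eq_bigr => i _.
have [sH _] := HH i (ltn_ord i).
have iGi := @induces_gexp _ D _ (dropN i (ltn_ord i)).
(* [slice_mul] refers to the chosen stem functions, which coincide on [D] with the explicit ones. *)
have e y : D y -> H i y * gstem (drop i lambda) y =
    stem_of D (slice_fun (H i)) y * stem_of D (gexp (drop i lambda)) y.
  move=> Dy; rewrite (stem_of_eq sH (iH i (ltn_ord i)) Dy).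
  by rewrite (stem_of_eq (@stem_gstem _ D _) iGi Dy).
have sHG := stemM sH (@stem_gstem _ D (drop i lambda)).
by rewrite /slice_mul (slice_fun_induces (stem_ext cD e sHG) Dz HJ) -e.
Qed.
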